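(* Let $f\colon\mathbb{T}^2\to\mathbb{T}^2$ be a homeomorphism homotopic to the identity which is a totally irrational pseudo-rotation, exhibits uniformly bounded rotational deviations, and has small wandering domains (for instance, $f$ is non-wandering). Then $f$ is a topological extension of the corresponding minimal rigid translation of $\mathbb{T}^2$; that is, if $\tilde f$ is a lift of $f$ with rotation set $\rho(\tilde f)=\{\bar\rho\}$, then there is a continuous surjective map $h\colon\mathbb{T}^2\to\mathbb{T}^2$ with $h\circ f=T_{\bar\rho}\circ h$, where $T_{\bar\rho}\colon\mathbb{T}^2\to\mathbb{T}^2$ is the translation by $\bar\rho$ mod $\mathbb{Z}^2$.
   Context: $\mathbb{T}^2=\mathbb{R}^2/\mathbb{Z}^2$ with quotient projection $\pi\colon\mathbb{R}^2\to\mathbb{T}^2$ and the distance induced by the Euclidean one. For a lift $\tilde f\colon\mathbb{R}^2\to\mathbb{R}^2$ of a homeomorphism $f$ of $\mathbb{T}^2$ homotopic to the identity, the rotation set is $$\rho(\tilde f)=\bigcap_{m\geq0}\overline{\bigcup_{n\geq m}\left\{\frac{\tilde f^n(z)-z}{n}:z\in\mathbb{R}^2\right\}}.$$ $f$ is a pseudo-rotation if $\rho(\tilde f)$ is a singleton for some (hence any) lift; it is a totally irrational pseudo-rotation if $\rho(\tilde f)=\{\bar\rho\}$ with $\bar\rho$ totally irrational, i.e. the translation $T_{\bar\rho}$ of $\mathbb{T}^2$ is minimal. A pseudo-rotation $f$ with $\rho(\tilde f)=\{\bar\rho\}$ exhibits uniformly bounded rotational deviations if there is $C>0$ such that $\|\tilde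 f^n(z)-z-n\bar\rho\|\leq C$ for all $z\in\mathbb{R}^2$, $n\in\mathbb{Z}$. An open set $U$ is wandering for $f$ if $f^n(U)\cap U=\emptyset$ for every $n\in\mathbb{Z}\setminus\{0\}$. $\Omega(f)$ is the set of points having no wandering neighborhood, $\mathscr{W}(f)=\mathbb{T}^2\setminus\Omega(f)$, and $f$ is non-wandering if $\Omega(f)=\mathbb{T}^2$. A connected open set $U\subset\mathbb{T}^2$ is lift-bounded if every connected component of $\pi^{-1}(U)$ is bounded in $\mathbb{R}^2$. $f$ has small wandering domains if every connected component of $\mathscr{W}(f)$ is lift-bounded and, for every $\delta>0$, only finitely many connected components of $\mathscr{W}(f)$ have diameter $\geq\delta$. *)

(* Defs.v *)
From HB Require Import structures.
From mathcomp Require Import all_boot all_order all_algebra.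
From mathcomp Require Import all_classical all_reals all_analysis.

Set Implicit Arguments.
Unset Strict Implicit.
Unset Printing Implicit Defensive.

Import Order.TTheory GRing.Theory Num.Theory.
Import numFieldNormedType.Exports.

Local Open Scope classical_set_scope.
Local Open Scope ring_scope.
Local Open Scope quotient_scope.

Record homeo (T : topologicalType) := Homeo {
  homeo_fun :> T -> T;
  homeo_inv : T -> T;
  homeoK : cancel homeo_fun homeo_inv;
  homeo_invK : cancel homeo_inv homeo_fun;
  homeo_continuous : continuous homeo_fun;
  homeo_inv_continuous : continuous homeo_inv }.

(* [Negz k] is the integer [- k.+1]. *)
Definition iterz (T : topologicalType) (f : homeo T) (n : int) : T -> T :=
  match n with
  | Posz k => iter k f
  | Negz k => iter k.+1 (homeo_inv f)
  end.

Definition homotopic (R : realType) (X Y : topologicalType) (f g : X -> Y) :=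
  exists H : R * X -> Y,
    [/\ {within `[0, 1] `*` setT, continuous H},
        forall x, H (0, x) = f x &
        forall x, H (1, x) = g x].

Definition minimal (T : topologicalType) (f : T -> T) :=
  forall K : set T, closed K -> f @` K = K -> K = set0 \/ K = setT.

Definition components (T : topologicalType) (A : set T) : set (set T) :=
  [set connected_component A x | x in A].

Definition wandering (T : topologicalType) (f : homeo T) (U : set T) :=
  open U /\ forall n : int, n != 0 -> (iterz f n @` U) `&` U = set0.

Definition nonwandering_set (T : topologicalType) (f : homeo T) : set T :=
  [set x | ~ exists U : set T, wandering f U /\ U x].

Definition wandering_set (T : topologicalType) (f : homeo T) : set T :=
  ~` nonwandering_set f.

Definition nonwandering (T : topologicalType) (f : homeo T) :=
  nonwandering_set f = setT.

Section Lattice.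
Variable R : realType.

Definition lattice : {pred R * R} :=
  fun z => (z.1 \is a Num.int) && (z.2 \is a Num.int).

Lemma lattice_zmod_closed : zmod_closed lattice.
Proof.
split=> [|x y /andP[x1 x2] /andP[y1 y2]]; rewrite /in_mem /=.
  by rewrite /lattice /= rpred0.
by rewrite /lattice /= !rpredB.
Qed.

HB.instance Definition _ :=
  GRing.isZmodClosed.Build (R * R)%type lattice lattice_zmod_closed.

End Lattice.

(* The additive group R^2 / Z^2, with the quotient topology. *)
Definition torus (R : realType) : Type :=
  quotient_topology (Quotient.quot (@lattice R)).

Section Torus.
Variable R : realType.
Implicit Types (z r : R * R) (x y : torus R) (U : set (torus R)).

Definition tproj z : torus R := \pi_(Quotient.quot (@lattice R)) z.

Definition translation r x : torus R :=
  (x : Quotient.quot (@lattice R)) + \pi_(Quotient.quot (@lattice R)) r.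

(* The library norm [`|z|] on [R * R] is the max norm. *)
Definition enorm z : R := Num.sqrt (z.1 ^+ 2 + z.2 ^+ 2).

Definition tdist x y : R :=
  inf [set enorm (ab.1 - ab.2) | ab in tproj @^-1` [set x] `*` tproj @^-1` [set y]].

Definition diameter U : \bar R :=
  ereal_sup [set (tdist xy.1 xy.2)%:E | xy in U `*` U].

Definition lift_bounded U :=
  forall V : set (R * R), components (tproj @^-1` U) V -> bounded_set V.

Definition small_wandering_domains (f : homeo (torus R)) :=
  (forall U, components (wandering_set f) U -> lift_bounded U) /\
  (forall delta : R, 0 < delta ->
     finite_set [set U | components (wandering_set f) U /\
                         (delta%:E <= diameter U)%E]).

(* A continuous lift of a torus homeomorphism homotopic to the identity is
   itself a homeomorphism of the plane. *)
Definition is_lift (F : homeo (R * R)%type) (f : homeo (torus R)) :=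
  forall z, tproj (F z) = f (tproj z).

(* The value at [n = 0] is irrelevant: the union over [n >= 1] is contained
   in the one over [n >= 0]. *)
Definition rotation_set (F : homeo (R * R)%type) : set (R * R) :=
  \bigcap_(m in [set: nat])
    closure (\bigcup_(n in [set n : nat | (m <= n)%N])
               [set n%:R^-1 *: (iter n F z - z) | z in [set: R * R]]).

Definition totally_irrational r := minimal (translation r).

Definition totally_irrational_pseudo_rotation (f : homeo (torus R)) :=
  exists F r, [/\ is_lift F f, rotation_set F = [set r] & totally_irrational r].

Definition uniformly_bounded_deviations (f : homeo (torus R)) :=
  exists F r, [/\ is_lift F f, rotation_set F = [set r] &
    exists2 C : R, 0 < C &
      forall z (n : int), enorm (iterz F n z - z - n%:~R *: r) <= C].

End Torus.

(* Main.v *)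
Require Import Defs.
From HB Require Import structures.
From mathcomp Require Import all_boot all_order all_algebra.
From mathcomp Require Import all_classical all_reals all_analysis.
From mathcomp Require Import ring lra zify.
Set Implicit Arguments.
Unset Strict Implicit.
Unset Printing Implicit Defensive.
Import Order.TTheory GRing.Theory Num.Theory.
Import numFieldNormedType.Exports.
Local Open Scope classical_set_scope.
Local Open Scope ring_scope.

(* The action of Z x Z^2 on the plane by G_g = F^n + m, g = (n, m), displaces points by
   gamma(g) = n r + m up to a bounded error.  It suffices to find, for each coordinate b,
   a continuous H with H o G_g = H + gamma(g)_b; surjectivity is then free by minimality.

   From the half planes one builds equivariant families U_s (increasing) and V_s
   (decreasing) of disjoint connected open sets, one on each side of a strip, each being
   the component of the complement of the closure of the other.  They define
   Hp x = inf {s | x in U_s} (upper semicontinuous) and Hm x = sup {t | x in V_t} (lower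
   semicontinuous); it is enough that the gap Hp - Hm be constant.  Let g0 be its infimum
   over the (lifted) non-wandering set.

   - At a non-wandering w with gap close to g0, returns G_g near w have gamma(g)_b small.
     As r is totally irrational, three returns are rationally independent, so some
     integer combination of them is a pure translation in the other coordinate.
     Ordering the steps so that gamma_b stays small yields a loop around the annulus
     inside the intersection of U_s and V_t with s - t close to g0; it separates U_t from
     V_s.  Hence the gap is at most g0 everywhere.
   - If the gap at x is less than g0, then x lies in a wandering domain O with boundary
     points y in V_t and y' in U_s, where Hp y - Hm y' > g0.  The iterates of O shrink,
     so at a limit point the gap exceeds g0. *)

(** * Plane topology *)

Section Grid.
Variable R : realType.
Implicit Types x y z e c : R.

Let opposite_signs x y c : `|x - y| < c -> (0 < x) != (0 < y) -> `|x| < c.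
Proof.
by move=> /ltr_normlP[? ?]; do 2 case: ltrP => ? //;
  rewrite ltr_norml => _; apply/andP; split; lra.
Qed.

Let same_sign x y e : `|x - y| < e -> 2 * e <= `|x| -> (0 < y) = (0 < x).
Proof.
move=> /ltr_normlP[? ?]; case: (ltrP 0 x) => x0.
  by rewrite gtr0_norm // => ?; lra.
by rewrite ler0_norm // => ?; apply/negP => ?; lra.
Qed.

Let two_steps x y z e : `|x - y| < e -> `|y - z| < e -> `|x - z| < 2 * e.
Proof.
by move=> xy yz; rewrite (le_lt_trans (ler_distD y _ _)) // mulr_natl mulr2n ltrD.
Qed.

(* Each grid edge carries the change of sign of [b], counted only where [a] is
   positive.  When [a] and [b] have no common approximate zero this cochain is
   closed, yet its sum along the boundary is -1. *)
Lemma grid_near_zero (a b : nat -> nat -> R) (n m : nat) (e : R) :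
  (forall i j, (i < n)%N -> (j <= m)%N ->
     `|a i j - a i.+1 j| < e /\ `|b i j - b i.+1 j| < e) ->
  (forall i j, (i <= n)%N -> (j < m)%N ->
     `|a i j - a i j.+1| < e /\ `|b i j - b i j.+1| < e) ->
  (forall j, (j <= m)%N -> a 0%N j < 0 /\ 0 < a n j) ->
  (forall i, (i <= n)%N -> 0 < b i 0%N /\ b i m < 0) ->
  exists i j, [/\ (i <= n)%N, (j <= m)%N, `|a i j| < 2 * e & `|b i j| < 2 * e].
Proof.
move=> stepi stepj Ha Hb; apply: contrapT => Hno.
have far i j : (i <= n)%N -> (j <= m)%N -> `|b i j| < 2 * e -> 2 * e <= `|a i j|.
  by move=> ? ? ?; rewrite leNgt; apply/negP => ?; apply: Hno; exists i, j.
pose phi i j : int := (0 < b i j)%R.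
pose hor i j : int := if 0 < a i j then phi i.+1 j - phi i j else 0.
pose ver i j : int := if 0 < a i j then phi i j.+1 - phi i j else 0.
have closed i j : (i < n)%N -> (j < m)%N ->
    hor i j + ver i.+1 j = ver i j + hor i j.+1.
  move=> iltn jltm; have [ilen jlem] := (ltnW iltn, ltnW jltm).
  have [a00_10 b00_10] := stepi i j iltn jlem.
  have [a01_11 b01_11] := stepi i j.+1 iltn jltm.
  have [a00_01 b00_01] := stepj i j ilen jltm.
  have [a10_11 b10_11] := stepj i.+1 j iltn jltm.
  have e0 : 0 < e by apply: le_lt_trans a00_10.
  have one_step x y : `|x - y| < e -> `|x - y| < 2 * e.
    by move=> /lt_trans; apply; rewrite mulr_natl mulr2n ltrDl.
  have far00 := far _ _ ilen jlem; have far01 := far _ _ ilen jltm.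
  (* If the four signs of [b] are not all equal, each corner has one of opposite sign at distance
     less than [2 * e] in value, so [b] is small at both left corners. There [a] is far from 0,
     hence of one sign on the three corners entering the identity, which becomes a telescoping of
     [phi]. *)
  have sameP : `|b i j| < 2 * e -> `|b i j.+1| < 2 * e ->
      hor i j + ver i.+1 j = ver i j + hor i j.+1.
    move=> /far00 g00 /far01 g01; rewrite /hor /ver.
    rewrite (same_sign a00_10 g00) (same_sign a00_01 g00).
    by case: ifP => // _; ring.
  have b00_11 := two_steps b00_10 b10_11.
  have b01_10 : `|b i j.+1 - b i.+1 j| < 2 * e.
    by rewrite (two_steps (y := b i j)) // distrC.
  move: sameP (one_step _ _ b00_10) (one_step _ _ b01_11) (one_step _ _ b00_01).
  rewrite /hor /ver /phi => sameP c00_10 c01_11 c00_01.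
  case s00: (0 < b i j); case s10: (0 < b i.+1 j);
  case s01: (0 < b i j.+1); case s11: (0 < b i.+1 j.+1);
  move: sameP; rewrite ?(s00, s10, s01, s11) => sameP;
  try (by rewrite !subrr !if_same);
  apply: sameP; 
   solve [ apply: (opposite_signs c00_10); rewrite s00 s10 //
    | apply: (opposite_signs c00_01); rewrite s00 s01 //
    | apply: (opposite_signs b00_11); rewrite s00 s11 //
    | apply: (opposite_signs b01_10); rewrite s01 s10 //
    | apply: (opposite_signs c01_11); rewrite s01 s11 //
    | rewrite distrC in c00_01; apply: (opposite_signs c00_01); rewrite s00 s01 //].
(* From row [j] to row [j.+1] the sum changes by the right edge only, the left one being killed by
   [a < 0]. It vanishes on the first and last rows, where [b] keeps its sign, although [phi] drops
   from 1 to 0 along the right column. *)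
pose S j := \sum_(i < n) hor i j.
have SS j : (j < m)%N -> S j.+1 - S j = phi n j.+1 - phi n j.
  move=> jltm; rewrite /S -sumrB.
  under eq_bigr => i _.
    have -> : hor i j.+1 - hor i j = ver i.+1 j - ver i j.
      by have := closed i j (ltn_ord i) jltm; lia.
    over.
  rewrite -(big_mkord xpredT (fun i => ver i.+1 j - ver i j)) telescope_sumr //.
  have [a0 an] := Ha j (ltnW jltm).
  by rewrite /ver an ltNge (ltW a0) /= subr0.
have phi0 i : (i <= n)%N -> phi i 0%N = 1 by move=> /Hb[h _]; rewrite /phi h.
have phim i : (i <= n)%N -> phi i m = 0.
  by move=> /Hb[_ h]; rewrite /phi ltNge (ltW h).
have S0 : S 0%N = 0.
  apply: big1 => i _; rewrite /hor; case: ifP => // _.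
  by rewrite !phi0 ?subrr // ltnW.
have Sm : S m = 0.
  apply: big1 => i _; rewrite /hor; case: ifP => // _.
  by rewrite !phim ?subrr // ltnW.
have : \sum_(0 <= j < m) (S j.+1 - S j) = \sum_(0 <= j < m) (phi n j.+1 - phi n j).
  by apply: eq_big_nat => j /andP[_ jm]; apply: SS.
by rewrite !telescope_sumr // S0 Sm phi0 // phim.
Qed.

End Grid.

(** * Connected sets, continua and their crossings in the plane *)

Section PlaneTopology.
Variable R : realType.
Local Notation P := (R * R)%type.
Implicit Types (x y z : P) (A S K : set P).

Lemma openP_norm A :
  open A <-> forall x, A x -> exists2 e, 0 < e & forall y, `|x - y| < e -> A y.
Proof.
rewrite openE; split => [H x /H|H x /H[e e0 eA]].
  by move/(nbhs_normP x A) => [e /= e0 eA]; exists e.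
by apply/(nbhs_normP x A); exists e.
Qed.

Lemma closureP_norm A x :
  closure A x <-> forall e, 0 < e -> exists2 y, A y & `|x - y| < e.
Proof.
split => [H e e0|H B /(nbhs_normP x B)[e /= e0 eA]].
  have [|y [Ay /= xy]] := H [set y | `|x - y| < e]; last by exists y.
  by apply/(nbhs_normP x [set y | `|x - y| < e]); exists e.
by have [y Ay xy] := H e e0; exists y; split => //; apply: eA.
Qed.

Lemma continuousP_norm (f : P -> P) : continuous f <->
  forall x e, 0 < e -> exists2 d, 0 < d & forall y, `|x - y| < d -> `|f x - f y| < e.
Proof.
split => [H x e e0|H x].
  have /cvgrPdist_lt/(_ e e0) := H x.
  by move=> /(nbhs_normP x)[d /= d0 dP]; exists d.
apply/cvgrPdist_lt => e e0; have [d d0 dP] := H x e e0.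
by apply/(nbhs_normP x); exists d.
Qed.

Lemma norm_lt x e : (`|x| < e) = (`|x.1| < e) && (`|x.2| < e).
Proof. by rewrite prod_normE gt_max. Qed.

Lemma norm_le x e : (`|x| <= e) = (`|x.1| <= e) && (`|x.2| <= e).
Proof. by rewrite prod_normE ge_max. Qed.

(** The trace of [A] on [S] is nonempty, open in [S], and also closed in [S] by the last
    hypothesis. *)
Lemma connected_subset_open S A : connected S -> open A -> S `&` A !=set0 ->
  (forall x, S x -> closure A x -> A x) -> S `<=` A.
Proof.
move=> cS oA SA clA; suff <- : S `&` A = S by move=> x [].
apply: cS => //; first by exists A.
exists (closure A); first exact: closed_closure.
by apply/seteqP; split => x [Sx Ax]; split => //; [exact: subset_closure|exact: clA].
Qed.

Lemma open_disjoint_closure A S : open A -> (forall x, A x -> ~ S x) ->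
  forall x, A x -> ~ closure S x.
Proof.
move=> oA AS x Ax clx.
by have [y [Sy Ay]] := clx A (open_nbhs_nbhs (conj oA Ax)); exact: AS Sy.
Qed.

Definition cball x e : set P := [set y | `|x - y| <= e].

Lemma cballE x e : cball x e = `[x.1 - e, x.1 + e] `*` `[x.2 - e, x.2 + e].
Proof.
apply/seteqP; split => y; rewrite /cball /= norm_le /= !in_itv /= !ler_norml.
  by move=> /andP[/andP[? ?] /andP[? ?]]; split; apply/andP; split; lra.
by move=> [/andP[? ?] /andP[? ?]]; apply/andP; split; apply/andP; split; lra.
Qed.

Lemma cball_compact x e : compact (cball x e).
Proof. by rewrite cballE; apply: compact_setX; apply: segment_compact. Qed.

(** The condition is star-shapedness about [x]: the set is a union of segments issued from [x]. *)
Lemma convex_connected A x : A x ->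
  (forall y (t : R), A y -> 0 <= t <= 1 -> A (x + t *: (y - x))) -> connected A.
Proof.
move=> Ax conv.
suff -> : A = \bigcup_(y in A) [set x + t *: (y - x) | t in `[0, 1]%classic].
  apply: bigcup_connected.
    by exists x => y _; exists 0; [rewrite /= in_itv /= lexx ler01|rewrite scale0r addr0].
  move=> y Ay; apply: connected_continuous_connected.
    by apply/connected_intervalP; apply: interval_is_interval.
  apply: continuous_subspaceT => t.
  by apply: cvgD; [exact: cvg_cst|exact: scalel_continuous].
apply/seteqP; split => [y Ay|z [y Ay [t /= t01 <-]]].
  exists y => //; exists 1; first by rewrite /= in_itv /= lexx ler01.
  by rewrite scale1r addrC subrK.
by apply: conv => //; move: t01; rewrite in_itv.
Qed.

Lemma cball_connected x e : 0 <= e -> connected (cball x e).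
Proof.
move=> e0; apply: (@convex_connected _ x); first by rewrite /cball /= subrr normr0.
move=> y t; rewrite /cball /= => xy /andP[t0 t1].
rewrite opprD addrA subrr add0r normrN normrZ ger0_norm // distrC.
by apply: le_trans xy; rewrite ler_piMl.
Qed.

Lemma ball_connected x e : 0 < e -> connected [set y | `|x - y| < e].
Proof.
move=> e0; apply: (@convex_connected _ x); first by rewrite /= subrr normr0.
move=> y t /= xy /andP[t0 t1].
rewrite opprD addrA subrr add0r normrN normrZ ger0_norm // distrC.
by apply: le_lt_trans xy; rewrite ler_piMl.
Qed.

Lemma ball_open x e : open [set y | `|x - y| < e].
Proof.
apply/openP_norm => y /= xy; exists (e - `|x - y|); first by rewrite subr_gt0.
by move=> z; rewrite ltrBrDl; apply: le_lt_trans; exact: ler_distD.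
Qed.

Lemma plane_connected : connected [set: P].
Proof. by apply: (@convex_connected _ 0). Qed.

(** Continua replace paths: they concatenate by union and map forward by images, with no
    parametrisation to manage. *)
Definition joined A x y :=
  exists K, [/\ compact K, connected K, K `<=` A, K x & K y].

Lemma joined_sym A x y : joined A x y -> joined A y x.
Proof. by move=> [K [? ? ? ? ?]]; exists K. Qed.

Lemma joined_trans A x y z : joined A x y -> joined A y z -> joined A x z.
Proof.
move=> [K [cK coK KA Kx Ky]] [L [cL coL LA Ly Lz]]; exists (K `|` L); split.
- exact: compactU.
- by apply: connectedU => //; exists y.
- by move=> u [/KA|/LA].
- by left.
- by right.
Qed.

Lemma joined_refl A x : A x -> joined A x x.
Proof.
by move=> Ax; exists [set x]; split => //; [exact: compact_set1|exact: connected1|move=> ? ->].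
Qed.

Lemma joined_image (f : P -> P) A B x y : continuous f -> f @` A `<=` B ->
  joined A x y -> joined B (f x) (f y).
Proof.
move=> cf fAB [K [cK coK KA Kx Ky]]; exists (f @` K); split.
- by apply: continuous_compact => //; exact: continuous_subspaceT.
- by apply: connected_continuous_connected => //; exact: continuous_subspaceT.
- by move=> _ [u Ku <-]; apply: fAB; exists u => //; exact: KA.
- by exists x.
- by exists y.
Qed.

(** Small closed balls are continua, so the points joined to [x] form a set that is open and
    relatively closed in [A]. *)
Lemma open_connected_joined A x y : open A -> connected A -> A x -> A y -> joined A x y.
Proof.
move=> oA cA Ax Ay.
have near z : A z -> exists2 e, 0 < e & forall u, `|z - u| < e -> joined A z u.
  move/openP_norm: oA => oA /oA[e e0 eA]; exists e => // u zu.
  exists (cball z `|z - u|); split.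
  - exact: cball_compact.
  - exact: cball_connected.
  - by move=> v /= vz; apply: eA; exact: le_lt_trans zu.
  - by rewrite /cball /= subrr normr0.
  - by rewrite /cball /=.
suff : A `<=` joined A x by apply.
apply: connected_subset_open => //.
- apply/openP_norm => z xz.
  have [|e e0 eA] := near z; first by case: xz => K [_ _ KA _ /KA].
  by exists e => // u /eA; exact: joined_trans.
- by exists x; split => //; exact: joined_refl.
move=> z Az /closureP_norm clz.
have [e e0 eA] := near z Az; have [u xu /eA zu] := clz e e0.
by apply: joined_trans xu _; exact: joined_sym.
Qed.

Definition chain e K x y := exists n (u : nat -> P), [/\ u 0%N = x, u n = y,
  forall i, (i <= n)%N -> K (u i) & forall i, (i < n)%N -> `|u i - u i.+1| < e].

(** The points within [e / 2] of a reachable point form an open set. It is relatively closed in [K]: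
    a limit point in [K] is within [e] of a reachable point, hence reachable itself. *)
Lemma connected_chain e K x y : 0 < e -> connected K -> K x -> K y -> chain e K x y.
Proof.
move=> e0 cK Kx Ky.
have chainS z u : chain e K x z -> `|z - u| < e -> K u -> chain e K x u.
  move=> [n [v [v0 vn Kv dv]]] zu Ku.
  exists n.+1, (fun i => if (i <= n)%N then v i else u); split => //.
  - by rewrite ltnn.
  - by move=> i _; case: ifP => // /Kv.
  move=> i; rewrite ltnS => ilen; rewrite ilen.
  case: (ltnP i n) => [iltn|nlei]; first exact: dv.
  by have -> : i = n; [apply/eqP; rewrite eqn_leq ilen|rewrite vn].
suff : K `<=` [set u | exists2 z, chain e K x z & `|z - u| < e / 2].
  by move=> /(_ y Ky)[z xz zy]; apply: chainS xz _ Ky; lra.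
have e20 : 0 < e / 2 by lra.
apply: connected_subset_open => //.
- apply/openP_norm => u [z xz zu]; exists (e / 2 - `|z - u|); first by rewrite subr_gt0.
  move=> v uv; exists z => //; rewrite (le_lt_trans (ler_distD u _ _)) //.
  by rewrite -ltrBrDl.
- exists x; split => //; exists x; last by rewrite subrr normr0.
  by exists 0%N, (fun=> x).
move=> v Kv /closureP_norm/(_ _ e20)[u [z xz zu] vu].
exists v; last by rewrite subrr normr0.
apply: chainS xz _ Kv; rewrite (le_lt_trans (ler_distD u _ _)) //.
by rewrite (distrC u); lra.
Qed.

Lemma compact_dist_pos K L : compact K -> compact L -> (forall x, K x -> ~ L x) ->
  exists2 d, 0 < d & forall x y, K x -> L y -> d <= `|x - y|.
Proof.
move=> cK cL KL.
have [[[x y] [/= Kx Ly]]|KL0] := pselect ((K `*` L) !=set0); last first.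
  by exists 1 => // x y Kx Ly; case: KL0; exists (x, y).
have [||[x0 y0] /set_mem[/= Kx0 Ly0] min] :=
    @compact_EVT_min _ R (fun xy : P * P => `|xy.1 - xy.2|) _ _ (compact_setX cK cL).
- by exists (x, y).
- apply: continuous_subspaceT => -[u v].
  apply: (@cvg_norm R^o); apply: cvgB; [exact: cvg_fst|exact: cvg_snd].
exists `|x0 - y0|.
  rewrite normr_gt0 subr_eq0; apply/eqP => xy; apply: (KL x0) => //.
  by rewrite xy.
by move=> u v Ku Lv; apply: (min (u, v)); apply/mem_set.
Qed.

(** A Boolean index lets one argument serve both coordinates; [~~ b] is then the other
    coordinate. *)
Definition crd (b : bool) z : R := if b then z.2 else z.1.

Lemma crdB b x y : crd b (x - y) = crd b x - crd b y.
Proof. by case: b. Qed.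

Lemma crdD b x y : crd b (x + y) = crd b x + crd b y.
Proof. by case: b. Qed.

Lemma norm_crd b x : `|crd b x| <= `|x|.
Proof. by rewrite prod_normE le_max; case: b; rewrite lexx ?orbT. Qed.

Lemma norm_crd_lt b x e : `|crd b x| < e -> `|crd (~~ b) x| < e -> `|x| < e.
Proof. by rewrite norm_lt; case: b => /= -> ->. Qed.

(** Disjoint continua would be at a positive distance [d]. The differences of two [d / 2]-chains,
    one along each continuum, satisfy the sign conditions of [grid_near_zero], which yields two
    chain points closer than [d]. *)
Lemma crossing b K L x y z w : compact K -> connected K -> compact L -> connected L ->
  K x -> K y -> L z -> L w ->
  (forall u, L u -> crd b x < crd b u < crd b y) ->
  (forall u, K u -> crd (~~ b) z < crd (~~ b) u < crd (~~ b) w) ->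
  exists u, K u /\ L u.
Proof.
move=> cK coK cL coL Kx Ky Lz Lw HL HK; apply: contrapT => KL.
have [d d0 dist] : exists2 d, 0 < d & forall x y, K x -> L y -> d <= `|x - y|.
  by apply: compact_dist_pos => // u Ku Lu; apply: KL; exists u.
have e0 : 0 < d / 2 by lra.
have [n [p [p0 pn Kp dp]]] := connected_chain e0 coK Kx Ky.
have [m [q [q0 qm Lq dq]]] := connected_chain e0 coL Lz Lw.
have [||||i [j [im jm]]] := @grid_near_zero _ (fun i j => crd b (p i - q j))
    (fun i j => crd (~~ b) (p i - q j)) n m (d / 2).
- move=> i j ni _; rewrite -!crdB.
  have -> : p i - q j - (p i.+1 - q j) = p i - p i.+1 by rewrite opprB addrA subrK.
  by split; apply: le_lt_trans (norm_crd _ _) (dp i ni).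
- move=> i j _ mj; rewrite -!crdB.
  have -> : p i - q j - (p i - q j.+1) = q j.+1 - q j.
    by rewrite opprB addrC addrA subrK.
  by split; apply: le_lt_trans (norm_crd _ _) _; rewrite distrC dq.
- move=> j /Lq /HL; rewrite p0 pn !crdB => /andP[? ?]; split; lra.
- move=> i /Kp /HK; rewrite q0 qm !crdB => /andP[? ?]; split; lra.
rewrite mulrC divfK // => ? ?.
have := dist _ _ (Kp i im) (Lq j jm); rewrite leNgt => /negP; apply.
exact: (@norm_crd_lt b).
Qed.

End PlaneTopology.

(** * Wandering domains of a plane action *)

Lemma finite_uniform_bound (R : realType) (T : choiceType) (A : set T) (Q : T -> R -> Prop) :
  finite_set A -> (forall a x y, x <= y -> Q a x -> Q a y) ->
  (forall a, A a -> exists x, Q a x) -> exists x, forall a, A a -> Q a x.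
Proof.
move=> /finite_seqP[s ->] Qmono; elim: s => [|a s IH] AQ.
  by exists 0 => a; rewrite /= in_nil.
have [|x xs] := IH; first by move=> c cs; apply: AQ; rewrite /= inE cs orbT.
have [|y ya] := AQ a; first by rewrite /= inE eqxx.
exists (Num.max x y) => c /=; rewrite inE => /predU1P[->|cs].
  by apply: Qmono ya; rewrite le_max lexx orbT.
by apply: (Qmono _ x); [rewrite le_max lexx|exact: xs].
Qed.

Lemma open_component (R : realType) (W : set (R * R)) z : open W ->
  open (connected_component W z).
Proof.
move=> /openP_norm oW; apply/openP_norm => x zx.
have [e e0 eW] := oW x (connected_component_sub zx); exists e => // y xy.
apply: connected_component_trans zx _.
apply: (@connected_component_max _ W [set y | `|x - y| < e]) => //.
  by rewrite /= subrr normr0.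
exact: ball_connected.
Qed.

Lemma closure_component (R : realType) (W : set (R * R)) z y : open W ->
  closure (connected_component W z) y -> W y -> connected_component W z y.
Proof.
move=> oW cly Wy.
have yW := conj (@open_component _ _ y oW) (connected_component_refl Wy).
have [u [zu yu]] := cly _ (open_nbhs_nbhs yW).
exact: connected_component_trans zu (connected_component_sym yu).
Qed.

Section Action.
Variable R : realType.
Local Notation P := (R * R)%type.
Local Notation T := (int * int * int)%type.

Definition vec (m n : int) : P := (m%:~R, n%:~R).

(** This is gamma(g), for [g = (n, p, q)] acting as the n-th iterate of the lift followed by the
    translation by (p, q). *)
Definition rotv (r : P) (g : T) : P := g.1.1%:~R *: r + vec g.1.2 g.2.

Lemma rotvD r g h : rotv r (g + h) = rotv r g + rotv r h.
Proof.
case: g h => [[n p] q] [[n' p'] q']; rewrite /rotv /vec /= !intrD scalerDl.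
by rewrite addrACA; congr (_ + _).
Qed.

Lemma rotv0 r : rotv r 0 = 0.
Proof. by apply: (addIr (rotv r 0)); rewrite -rotvD !add0r. Qed.

Lemma rotvN r g : rotv r (- g) = - rotv r g.
Proof. by apply: (addIr (rotv r g)); rewrite -rotvD !addNr rotv0. Qed.

Lemma rotvMn r g k : rotv r (g *+ k) = rotv r g *+ k.
Proof. by elim: k => [|k IH]; rewrite ?rotv0 // !mulrS rotvD IH. Qed.

(** [act_irr] is the rational independence of [r.1], [r.2] and 1; [act_dev] is the bounded
    deviation, in the max norm. *)
Record plane_action (G : T -> P -> P) (r : P) (C : R) : Prop := PlaneAction {
  act0 : forall z, G 0 z = z;
  actD : forall g h z, G (g + h) z = G g (G h z);
  act_continuous : forall g, continuous (G g);
  act_translation : forall m n z, G (0, m, n) z = z + vec m n;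
  act_dev : forall g z, `|G g z - z - rotv r g| <= C;
  act_irr : forall a c d : int,
    a%:~R * r.1 + c%:~R * r.2 + d%:~R = 0 -> [/\ a = 0, c = 0 & d = 0] }.

(** Finiteness is only asked of large components meeting a given ball, since lattice translations
    produce infinitely many copies of each component. *)
Record small_domains (W : set P) : Prop := SmallDomains {
  dom_bounded : forall z, exists d, forall x, connected_component W z x -> `|x| <= d;
  dom_finite : forall e d : R, 0 < e -> finite_set
    [set O | components W O /\ (exists2 x, O x & `|x| <= d) /\
       exists x y, [/\ O x, O y & e <= `|x - y|]] }.

Section Domains.
Variables (G : T -> P -> P) (r : P) (C : R) (W : set P).
Hypotheses (HG : plane_action G r C) (HW : small_domains W).
Hypotheses (oW : open W) (WG : forall g z, W z -> W (G g z)).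
Hypothesis NW : forall w, ~ W w -> forall (e : R) (N : nat), 0 < e ->
  exists u g, [/\ `|w - u| < e, `|w - G g u| < e & (N <= `|g.1.1|)%N].

Local Notation comp := (connected_component W).

Lemma actK g z : G (- g) (G g z) = z.
Proof. by rewrite -(actD HG) addNr (act0 HG). Qed.

Lemma actNK g z : G g (G (- g) z) = z.
Proof. by rewrite -{1}(opprK g) actK. Qed.

Lemma comp_act g z x : comp z x -> comp (G g z) (G g x).
Proof.
move=> [B [Bz BW cB] Bx].
exists (G g @` B); last by exists x.
split; [by exists z|by move=> _ [u /BW Wu <-]; exact: WG|].
apply: connected_continuous_connected => //; apply: continuous_subspaceT.
exact: (act_continuous HG).
Qed.

Lemma rotv_neq0 g : g.1.1 != 0 -> rotv r g != 0.
Proof.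
case: g => [[n p] q] /= n0; apply/eqP => /(congr1 fst) /=.
rewrite /GRing.scale /= => E.
have [|n00 _ _] := @act_irr _ _ _ HG n 0 p; first by rewrite mul0r addr0.
by rewrite n00 eqxx in n0.
Qed.

Lemma act_escapes g z d : g.1.1 != 0 -> exists k, d < `|G (g *+ k) z - z|.
Proof.
move=> /rotv_neq0; rewrite -normr_gt0 => g0.
have [k Hk] : exists k : nat, d + C < `|rotv r g| * k%:R.
  exists (Num.bound `|(d + C) / `|rotv r g| |).
  rewrite mulrC -ltr_pdivrMr //.
  by rewrite (le_lt_trans (ler_norm _)) // archi_boundP.
exists k; have := act_dev HG (g *+ k) z; rewrite rotvMn.
move: Hk; rewrite mulr_natr -normrMn; set x := G _ _ - z; set y := _ *+ k => dy xy.
have : `|y| <= `|x| + `|x - y| by rewrite -{1}[y](subKr x) ler_normB.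
lra.
Qed.

(** A component sent to itself by [g] is preserved by all multiples of [g], whose displacements are
    unbounded, whereas the component is bounded. *)
Lemma comp_act_neq g z : g.1.1 != 0 -> ~ comp z (G g z).
Proof.
move=> gn zgz; have zz := connected_component_trans zgz (connected_component_sym zgz).
have all k : comp z (G (g *+ k) z).
  elim: k => [|k IH]; first by rewrite mulr0n (act0 HG).
  rewrite mulrS (actD HG); apply: connected_component_trans zgz _; exact: comp_act.
have [d Hd] := dom_bounded HW z.
have [k] := act_escapes z (d + d) gn; apply/negP; rewrite -leNgt.
by rewrite (le_trans (ler_normB _ _)) // lerD ?Hd.
Qed.

(** The element of time [n] whose rotation vector is the fractional part of [n r]; orbits of a point
    under these elements stay in a fixed box. *)
Definition bring (n : int) : T := (n, - Num.floor (n%:~R * r.1), - Num.floor (n%:~R * r.2)).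

Lemma rotv_bring n : `|rotv r (bring n)| <= 1.
Proof.
rewrite norm_le /rotv /vec /= !rmorphN /=.
have h (x : R) : `|x - (Num.floor x)%:~R| <= 1.
  rewrite ger0_norm ?subr_ge0 ?floor_le //.
  by rewrite lerBlDr addrC ltW // -intrD1 floorD1_gt.
by rewrite /GRing.scale /= !h.
Qed.

Lemma act_norm_le g z : `|G g z| <= `|z| + C + `|rotv r g|.
Proof.
have -> : G g z = z + (G g z - z - rotv r g) + rotv r g by rewrite -addrA subrK addrC subrK.
by rewrite (le_trans (ler_normD _ _)) // lerD2r (le_trans (ler_normD _ _)) // lerD2l (act_dev HG).
Qed.

Lemma act_split g m n z : G (g + (0, m, n)) z = G g z + vec m n.
Proof. by rewrite addrC (actD HG) (act_translation HG). Qed.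

Lemma bringE g : exists m n, forall z, G (bring g.1.1) z = G g z + vec m n.
Proof.
case: g => [[n p] q] /=.
exists (- Num.floor (n%:~R * r.1) - p), (- Num.floor (n%:~R * r.2) - q) => z.
by rewrite -act_split; congr (G _ _); congr (_, _, _) => /=; ring.
Qed.

(* The components [comp (G (bring n) z)] are pairwise distinct and meet a fixed box. *)
Lemma component_shrinks z e : W z -> 0 < e -> exists N : nat, forall g, (N <= `|g.1.1|)%N ->
  forall x y, comp z x -> comp z y -> `|G g x - G g y| < e.
Proof.
move=> Wz e0.
pose large := [set n : int | exists x y,
  [/\ comp z x, comp z y & e <= `|G (bring n) x - G (bring n) y|]].
have fin_large : finite_set large.
  have := dom_finite HW (`|z| + C + 1) e0; set F := [set O | _] => finF.
  apply: (@sub_finite_set _ _ ((fun n => comp (G (bring n) z)) @^-1` F)).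
    move=> n [x [y [zx zy xy]]]; split; [|split].
    - by exists (G (bring n) z) => //; exact: WG.
    - exists (G (bring n) z); first exact/connected_component_refl/WG.
      by rewrite (le_trans (act_norm_le _ _)) // lerD2l rotv_bring.
    - by exists (G (bring n) x), (G (bring n) y); split => //; exact: comp_act.
  apply: finite_preimage => // n n' _ _ /= E.
  apply/eqP; rewrite -subr_eq0; apply/negPn/negP => nn'.
  apply: (@comp_act_neq (bring n - bring n') (G (bring n') z)) => //.
  rewrite -(actD HG) subrK -E; exact/connected_component_refl/WG.
have [||N HN] := @finite_uniform_bound R _ large (fun n x => `|n|%N%:R < x) fin_large.
- by move=> n x y xy /lt_le_trans; apply.
- by move=> n _; exists (`|n|%N%:R + 1); rewrite ltrDl.
exists (Num.bound `|N|) => g ng x y zx zy; rewrite ltNge; apply/negP => xy.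
have [m [n E]] := bringE g.
have /HN : large g.1.1.
  exists x, y; split => //; rewrite !E.
  by rewrite opprD addrACA subrr addr0.
apply/negP; rewrite -leNgt; apply: (@le_trans _ _ (Num.bound `|N|)%:R); last by rewrite ler_nat.
by rewrite (le_trans (ler_norm _)) // ltW // archi_boundP.
Qed.

Lemma closure_component_shrinks z e : W z -> 0 < e -> exists N : nat, forall g, (N <= `|g.1.1|)%N ->
  forall x y, closure (comp z) x -> closure (comp z) y -> `|G g x - G g y| < e.
Proof.
move=> Wz e0; have e30 : 0 < e / 3 by lra.
have [N HN] := component_shrinks Wz e30; exists N => g ng x y.
have appr u : closure (comp z) u -> exists2 v, comp z v & `|G g u - G g v| < e / 3.
  have [d d0 Hd] := proj1 (continuousP_norm _) (@act_continuous _ _ _ HG g) u _ e30.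
  by move=> /closureP_norm/(_ d d0)[v zv uv]; exists v => //; exact: Hd.
move=> /appr[u zu xu] /appr[v zv yv].
have uv := HN g ng u v zu zv.
rewrite (le_lt_trans (ler_distD (G g u) _ _)) //.
have := ler_distD (G g v) (G g u) (G g y); rewrite (distrC (G g v) (G g y)).
lra.
Qed.

(** Without such a point the component would be clopen, hence the whole plane, contradicting its
    boundedness. *)
Lemma component_boundary z : W z -> exists2 y, closure (comp z) y & ~ W y.
Proof.
move=> Wz; apply: contrapT => Hno.
have full : [set: P] `<=` comp z.
  apply: connected_subset_open; [exact: plane_connected|exact: open_component| |].
    by exists z; split => //; exact: connected_component_refl.
  move=> x _ clx; apply: closure_component => //.
  by apply: contrapT => Wx; apply: Hno; exists x.
have [d Hd] := dom_bounded HW z.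
have := Hd (d + 1, 0) (full _ I); rewrite norm_le /= => /andP[+ _].
by have := ler_norm (d + 1); lra.
Qed.

(* The restriction of the dynamics to the complement of [W] is again non-wandering:
   a return through a small component can be moved to its boundary, while a large
   component near [w] either avoids a neighbourhood of [w] or has [w] on its boundary,
   and is then shrunk by the return. *)
Lemma nonwandering_restricted w (e : R) (N : nat) : ~ W w -> 0 < e ->
  exists u g, [/\ ~ W u, `|w - u| < e, `|w - G g u| < e & (N <= `|g.1.1|)%N].
Proof.
move=> Ww e0; have e20 : 0 < e / 2 by lra.
pose F := [set O | components W O /\ (exists2 x, O x & `|x| <= `|w| + e) /\
       exists x y, [/\ O x, O y & e / 2 <= `|x - y|]].
have finF : finite_set F := dom_finite HW (`|w| + e) e20.
(* [N1] is a time past which the image of every large component has diameter less than [e / 2]. *)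
have [||N1 HN1] := @finite_uniform_bound R _ F (fun O t => forall g, t <= `|g.1.1|%N%:R ->
  forall x y, closure O x -> closure O y -> `|G g x - G g y| < e / 2) finF.
- by move=> O t t' tt' H g /(le_trans tt'); exact: H.
- move=> O [[z Wz <-] _]; have [k Hk] := closure_component_shrinks Wz e20.
  by exists k%:R => g; rewrite ler_nat; exact: Hk.
(* A large component whose closure misses [w] stays at distance at least [M^-1] from [w]. *)
have [||M HM] := @finite_uniform_bound R _ F (fun O t => 0 < t /\
  (~ closure O w -> forall x, O x -> t^-1 <= `|w - x|)) finF.
- move=> O t t' tt' [t0 H]; split; first exact: lt_le_trans tt'.
  move=> /H{}H x /H; apply: le_trans; rewrite lef_pV2 // posrE //.
  exact: lt_le_trans tt'.
- move=> O _; have [clw|clw] := pselect (closure O w); first by exists 1; split.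
  have [d d0 Hd] : exists2 d, 0 < d & forall x, O x -> d <= `|w - x|.
    apply: contrapT => Hno; apply: clw; apply/closureP_norm => d d0.
    apply: contrapT => Hd; apply: Hno; exists d => // x Ox.
    by rewrite leNgt; apply/negP => xd; apply: Hd; exists x.
  by exists d^-1; rewrite invr_gt0 invrK.
pose d := Num.min (e / 4) (Num.max 1 M)^-1.
have M0 : 0 < Num.max 1 M by rewrite lt_max ltr01.
have d0 : 0 < d by rewrite lt_min invr_gt0 M0 andbT; lra.
have dM O x : F O -> O x -> `|w - x| < d -> closure O w.
  move=> FO Ox wx; apply: contrapT => /(HM _ FO).2/(_ x Ox).
  apply/negP; rewrite -ltNge (lt_le_trans wx) // ge_min; apply/orP; right.
  rewrite lef_pV2 ?posrE // ?le_max ?lexx ?orbT //.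
  by have [] := HM _ FO.
have [u [g [wu wgu gN]]] := NW Ww (maxn N (Num.bound `|N1|)) d0.
have /andP[N1g Ng] : (N1 <= `|g.1.1|%N%:R) && (N <= `|g.1.1|)%N.
  move: gN; rewrite geq_max => /andP[-> h]; rewrite andbT.
  apply: (@le_trans _ _ (Num.bound `|N1|)%:R); last by rewrite ler_nat.
  by rewrite (le_trans (ler_norm _)) // ltW // archi_boundP.
have de : d <= e / 4 by rewrite ge_min lexx.
have near_bound x : `|w - x| < d -> `|x| <= `|w| + e.
  move=> wx; rewrite -[x](subKr w) (le_trans (ler_normB _ _)) // lerD2l; lra.
have [Wu|Wu] := pselect (W u); last by exists u, g; split => //; lra.
(* If [u] is in a large component, [w] is on its boundary and serves as the starting point: its
   image follows that of [u], the component being shrunk. *)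
have [Fu|Fu] := pselect (F (comp u)).
  have clw := dM _ _ Fu (connected_component_refl Wu) wu.
  exists w, g; split => //; first by rewrite subrr normr0.
  have uw := HN1 _ Fu g N1g u w (subset_closure (connected_component_refl Wu)) clw.
  by rewrite (le_lt_trans (ler_distD (G g u) _ _)) //; lra.
have WGu := WG g Wu.
(* If the endpoint is in a large component, [w] serves as the endpoint and is pulled back by [- g],
   which shrinks that component. *)
have [Fgu|Fgu] := pselect (F (comp (G g u))).
  have clw := dM _ _ Fgu (connected_component_refl WGu) wgu.
  exists (G (- g) w), g; split => //.
  - by move=> /(WG g); rewrite actNK.
  - have := HN1 _ Fgu (- g); rewrite abszN => /(_ N1g (G g u) w).
    move=> /(_ (subset_closure (connected_component_refl WGu)) clw).
    rewrite actK => uw.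
    by rewrite (le_lt_trans (ler_distD u _ _)) //; lra.
  - by rewrite actNK subrr normr0.
have small x y z : W z -> `|w - z| < d -> ~ F (comp z) -> comp z x -> comp z y -> `|x - y| < e / 2.
  move=> Wz wz Fz zx zy; rewrite ltNge; apply/negP => xy; apply: Fz.
  split; [by exists z|split]; last by exists x, y.
  by exists z; [exact: connected_component_refl|exact: near_bound].
have smallcl x z : W z -> `|w - z| < d -> ~ F (comp z) -> closure (comp z) x -> `|w - x| < e.
  move=> Wz wz Fz /closureP_norm clx.
  have e40 : 0 < e / 4 by lra.
  have [v zv xv] := clx _ e40.
  have := small _ _ _ Wz wz Fz (connected_component_refl Wz) zv.
  have := ler_distD z w x; have := ler_distD v z x; rewrite (distrC v x); lra.
(* Both components are small: any boundary point of the first works, its image being in the closure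
   of the second. *)
have [x clx Wx] := component_boundary Wu.
exists x, g; split => //; first exact: smallcl clx.
apply: (smallcl _ (G g u)) => //; apply/closureP_norm => t t0.
have [s s0 Hs] := proj1 (continuousP_norm _) (@act_continuous _ _ _ HG g) x _ t0.
by move/closureP_norm: clx => /(_ s s0)[y uy xy]; exists (G g y); [exact: comp_act|exact: Hs].
Qed.

End Domains.
End Action.

(** * Barriers *)

Section Sides.
Variable R : realType.
Local Notation P := (R * R)%type.
Implicit Types (A B S : set P) (b : bool) (sg N : R).

Definition half b sg N : set P := [set x | N < sg * crd b x].

(** The component of the complement of [closure A] containing a half plane on the side given by the
    sign of [sg]; it is empty if every such half plane meets [closure A]. *)
Definition side b sg A : set P := [set x | exists S, [/\ connected S,
  (forall y, S y -> ~ closure A y), (exists N, half b sg N `<=` S) & S x]].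

Lemma crdZ b (t : R) (x : P) : crd b (t *: x) = t * crd b x.
Proof. by case: b. Qed.

Lemma half_mono b sg N N' : N <= N' -> half b sg N' `<=` half b sg N.
Proof. by move=> NN x; apply: le_lt_trans. Qed.

Lemma half_nonempty b sg N : sg != 0 -> half b sg N !=set0.
Proof.
move=> sg0; exists (sg^-1 * (N + 1), sg^-1 * (N + 1)).
rewrite /half /= (_ : crd b _ = sg^-1 * (N + 1)); last by case: b.
by rewrite mulVKf // ltrDl.
Qed.

Lemma half_connected b sg N : sg != 0 -> connected (half b sg N).
Proof.
move=> sg0; have [x Hx] := half_nonempty b N sg0.
apply: (convex_connected Hx) => y t Hy /andP[t0 t1].
rewrite /half /= crdD crdZ crdB.
move: Hx Hy; rewrite /half /= => Hx Hy.
have -> : sg * (crd b x + t * (crd b y - crd b x)) =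
  (1 - t) * (sg * crd b x) + t * (sg * crd b y) by ring.
have := ler_wpM2l t0 (ltW Hy).
case: (ltrP t 1) => [t1'|t1']; last by (have -> : t = 1 by lra); lra.
have t2 : 0 < 1 - t by lra.
have := Hx; rewrite -(ltr_pM2l t2) => ? ?.
lra.
Qed.

Lemma half_open b sg N : sg != 0 -> open (half b sg N).
Proof.
move=> sg0; apply/openP_norm => x; rewrite /half /= => Hx.
exists ((sg * crd b x - N) / `|sg|); first by rewrite divr_gt0 ?normr_gt0 ?subr_gt0.
move=> y; rewrite ltr_pdivlMr ?normr_gt0 // => xy.
have := le_lt_trans (ler_wpM2r (normr_ge0 sg) (norm_crd b (x - y))) xy.
by rewrite -normrM crdB mulrC => /ltr_normlP[]; rewrite mulrBr; lra.
Qed.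

(** Any two admissible sets share a half plane, so their union is connected. *)
Lemma side_connected b sg A : sg != 0 -> connected (side b sg A).
Proof.
move=> sg0; have [[x [S0 [cS0 S0A [N0 HN0] S0x]]]|side0] := pselect (side b sg A !=set0);
  last first.
  suff -> : side b sg A = set0 by exact: connected0.
  by apply/seteqP; split => // x sx; apply: side0; exists x.
pose good := [set S | [/\ connected S, (forall y, S y -> ~ closure A y) &
  (exists N, half b sg N `<=` S)]].
have -> : side b sg A = \bigcup_(S in good) (S0 `|` S).
  apply/seteqP; split => y.
    by move=> [S [cS SA HS Sy]]; exists S => //; right.
  move=> [S [cS SA HS] [S0y|Sy]]; last by exists S.
  by exists S0; split => //; exists N0.
apply: bigcup_connected; first by exists x => S _; left.
move=> S [cS SA [N HN]]; apply: connectedU => //.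
have [y Hy] := half_nonempty b (Num.max N0 N) sg0.
by exists y; split; [apply: HN0|apply: HN]; apply: half_mono Hy; rewrite le_max lexx ?orbT.
Qed.

Lemma side_open b sg A : open (side b sg A).
Proof.
apply/openP_norm => x [S [cS SA [N HN] Sx]].
have /openP_norm/(_ x (SA x Sx))[e e0 He] : open (~` closure A).
  by rewrite openC; exact: closed_closure.
exists e => // y xy; exists (S `|` [set y | `|x - y| < e]); split.
- apply: connectedU => //; last exact: ball_connected.
  by exists x; split => //=; rewrite subrr normr0.
- by move=> z [/SA|/He].
- by exists N => z /HN; left.
- by right.
Qed.

Lemma side_disjoint b sg A x : side b sg A x -> ~ closure A x.
Proof. by move=> [S [_ SA _ /SA]]. Qed.

Lemma side_max b sg A S : connected S -> (forall y, S y -> ~ closure A y) ->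
  (exists N, half b sg N `<=` S) -> S `<=` side b sg A.
Proof. by move=> cS SA HS x Sx; exists S. Qed.

Lemma half_side b sg A N : sg != 0 -> (forall x, A x -> sg * crd b x <= N) ->
  half b sg N `<=` side b sg A.
Proof.
move=> sg0 AN; apply: side_max; [exact: half_connected| |by exists N].
apply: open_disjoint_closure; first exact: half_open.
by move=> x; rewrite /half /= ltNge => /negP xN /AN.
Qed.

Lemma side_anti b sg A B : A `<=` B -> side b sg B `<=` side b sg A.
Proof.
move=> AB x [S [cS SB HS Sx]]; exists S; split => // y Sy.
by move=> /(closureS AB); exact: SB.
Qed.

(** Being open and disjoint from its own side, [A] is also disjoint from the closure of that side,
    and is thus a competitor in the definition of the opposite one. *)
Lemma side_side b sg sg' A N : connected A -> open A -> half b sg' N `<=` A ->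
  A `<=` side b sg' (side b sg A).
Proof.
move=> cA oA HA; apply: side_max => //; last by exists N.
apply: open_disjoint_closure => // x Ax /side_disjoint; apply.
exact: subset_closure.
Qed.

(** A homeomorphism at bounded distance from the identity maps a half plane onto a set containing a
    half plane on the same side. *)
Lemma side_image b sg (f g : P -> P) A B x (c : R) : continuous f -> continuous g ->
  cancel f g -> cancel g f -> (forall y, `|y - g y| <= c) ->
  (forall y, A y -> B (g y)) -> side b sg B x -> side b sg A (f x).
Proof.
move=> cf cg fK gK gc AB [S [cS SB [N HN] Sx]].
exists (f @` S); split.
- by apply: connected_continuous_connected => //; exact: continuous_subspaceT.
- move=> _ [y Sy <-] /closureP_norm cl; apply: (SB y Sy); apply/closureP_norm => e e0.
  have [d d0 Hd] := proj1 (continuousP_norm g) cg (f y) e e0.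
  have [z Az fyz] := cl d d0; exists (g z); first exact: AB.
  by rewrite -{1}(fK y); exact: Hd.
- exists (N + `|sg| * c) => y Hy; exists (g y) => //; apply: HN; move: Hy; rewrite /half /=.
  have := le_trans (norm_crd b (y - g y)) (gc y).
  move=> /(ler_wpM2l (normr_ge0 sg)); rewrite -normrM crdB mulrBr => /ler_normlP[]; lra.
- by exists x.
Qed.

End Sides.

(** * Equivariant families of mutually maximal barriers *)

Section Barriers.
Variable R : realType.
Local Notation P := (R * R)%type.
Local Notation T := (int * int * int)%type.
Variables (G : T -> P -> P) (r : P) (C : R) (b : bool).
Hypothesis HG : plane_action G r C.

Definition rotc g := crd b (rotv r g).

(** Outside a strip of width [M] the two sets are the half planes. The fields [bar_maxl] and
    [bar_maxr] express that each set is the component of the complement of the closure of the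
    other. *)
Record barriers (M : R) (U V : R -> set P) : Prop := Barriers {
  bar_openl : forall s, open (U s);
  bar_openr : forall s, open (V s);
  bar_connectedl : forall s, connected (U s);
  bar_connectedr : forall s, connected (V s);
  bar_disj : forall s x, U s x -> ~ V s x;
  bar_monol : forall s t, s <= t -> U s `<=` U t;
  bar_monor : forall s t, s <= t -> V t `<=` V s;
  bar_actl : forall g s x, U s x -> U (s + rotc g) (G g x);
  bar_actr : forall g s x, V s x -> V (s + rotc g) (G g x);
  bar_lowl : forall s x, crd b x < s -> U s x;
  bar_upl : forall s x, U s x -> crd b x <= s + M;
  bar_lowr : forall s x, V s x -> s <= crd b x;
  bar_upr : forall s x, s + M < crd b x -> V s x;
  bar_maxl : forall s S, connected S -> (forall y, S y -> ~ closure (V s) y) ->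
    (exists N, forall x, crd b x < N -> S x) -> S `<=` U s;
  bar_maxr : forall s S, connected S -> (forall y, S y -> ~ closure (U s) y) ->
    (exists N, forall x, N < crd b x -> S x) -> S `<=` V s }.

(** The union of the images of the open half plane at level [s] under the action, each corrected by
    its rotation: the least equivariant family containing the half planes. *)
Let below (s : R) : set P := [set x | exists g, crd b (G g x) - rotc g < s].

(** Taking sides alternately, starting from [below], stabilises as in a Galois connection. Bounded
    deviations keep every set within the strip, and each operation commutes with the action. *)
Lemma barriers_exist : exists M U V, barriers M U V.
Proof.
have below_up s x : below s x -> crd b x <= s + C.
  move=> [g]; have := le_trans (norm_crd b _) (act_dev HG g x).
  by rewrite !crdB -/(rotc g) => /ler_normlP[]; lra.
have below_low s x : crd b x < s -> below s x.
  move=> xs; exists 0.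
  by rewrite (act0 HG) /rotc rotv0 (_ : crd b 0 = 0) ?subr0 //; case: (b).
have below_mono s t : s <= t -> below s `<=` below t.
  by move=> st x [g gx]; exists g; exact: lt_le_trans gx st.
have below_act g s x : below s x -> below (s + rotc g) (G g x).
  move=> [h hs]; exists (h - g).
  by rewrite (actD HG) (actK HG) /rotc rotvD rotvN crdB -/(rotc h) -/(rotc g); lra.
have n10 : (1 : R) != 0 by exact: oner_neq0.
have nN10 : (- 1 : R) != 0 by rewrite oppr_eq0.
pose V0 s := side b 1 (below s).
pose U0 s := side b (- 1) (V0 s).
pose V s := side b 1 (U0 s).
pose U s := side b (- 1) (V s).
have side_act (A : R -> set P) sg : (forall g s x, A s x -> A (s + rotc g) (G g x)) ->
    forall g s x, side b sg (A s) x -> side b sg (A (s + rotc g)) (G g x).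
  move=> HA g s x; apply: (@side_image _ _ _ (G g) (G (- g)) _ _ _ (C + `|rotv r g|)).
  - exact: (@act_continuous _ _ _ _ HG g).
  - exact: (@act_continuous _ _ _ _ HG (- g)).
  - exact: (actK HG g).
  - exact: (actNK HG g).
  - move=> y; rewrite distrC; have := act_dev HG (- g) y; rewrite rotvN opprK.
    set z := G _ _ => zy.
    by rewrite -[z - y](addrK (rotv r g)) (le_trans (ler_normB _ _)) // lerD2r.
  - move=> y /(HA (- g)); rewrite /rotc rotvN.
    by rewrite (_ : crd b (- _) = - crd b (rotv r g)) ?addrK //; case: (b).
have V0act := side_act _ 1 below_act; have U0act := side_act _ (- 1) V0act.
have Vact := side_act _ 1 U0act; have Uact := side_act _ (- 1) Vact.
have V0_up s x : s + C < crd b x -> V0 s x.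
  move=> xs; apply: (half_side (N := s + C)) => //; last by rewrite /half /= mul1r.
  by move=> y /below_up; rewrite mul1r.
have V0_low s x : V0 s x -> s <= crd b x.
  move=> /side_disjoint H; rewrite leNgt; apply/negP => xs; apply: H.
  exact/subset_closure/below_low.
have U0_low s x : crd b x < s -> U0 s x.
  move=> xs; apply: (half_side (N := - s)) => //; last by rewrite /half /= mulN1r ltrN2.
  by move=> y /V0_low; rewrite mulN1r lerN2.
have U0_up s x : U0 s x -> crd b x <= s + C.
  move=> /side_disjoint H; rewrite leNgt; apply/negP => xs; apply: H.
  exact/subset_closure/V0_up.
have V_up s x : s + C < crd b x -> V s x.
  move=> xs; apply: (half_side (N := s + C)) => //; last by rewrite /half /= mul1r.
  by move=> y /U0_up; rewrite mul1r.
have V_low s x : V s x -> s <= crd b x.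
  move=> /side_disjoint H; rewrite leNgt; apply/negP => xs; apply: H.
  exact/subset_closure/U0_low.
have U_low s x : crd b x < s -> U s x.
  move=> xs; apply: (half_side (N := - s)) => //; last by rewrite /half /= mulN1r ltrN2.
  by move=> y /V_low; rewrite mulN1r lerN2.
have U_up s x : U s x -> crd b x <= s + C.
  move=> /side_disjoint H; rewrite leNgt; apply/negP => xs; apply: H.
  exact/subset_closure/V_up.
(* This inclusion gives [side b 1 (U s)] inside [V s], hence the maximality of [V]; that of [U]
   holds by definition. *)
have U0U s : U0 s `<=` U s.
  apply: (@side_side _ _ _ _ _ (- s)); [exact: side_connected|exact: side_open|].
  by move=> x; rewrite /half /= mulN1r ltrN2; exact: U0_low.
have V0mono s t : s <= t -> V0 t `<=` V0 s by move=> st; apply/side_anti/below_mono.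
have U0mono s t : s <= t -> U0 s `<=` U0 t by move=> st; apply/side_anti/V0mono.
have Vmono s t : s <= t -> V t `<=` V s by move=> st; apply/side_anti/U0mono.
exists C, U, V; split => //.
- by move=> s; exact: side_open.
- by move=> s; exact: side_open.
- by move=> s; exact: side_connected.
- by move=> s; exact: side_connected.
- by move=> s x /side_disjoint Ux Vx; apply: Ux; exact: subset_closure.
- by move=> s t st; apply/side_anti/Vmono.
- move=> s S cS SV [N HN]; apply: side_max => //; exists (- N) => x.
  by rewrite /half /= mulN1r ltrN2 => /HN.
- move=> s S cS SU [N HN]; apply: subset_trans (side_anti (@U0U s)).
  apply: side_max => //; exists N => x.
  by rewrite /half /= mul1r => /HN.
Qed.

End Barriers.

(** * Level functions of the barriers *)

Lemma compact_nbhd (R : realType) (K A : set (R * R)) : compact K -> open A -> K `<=` A ->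
  exists2 e, 0 < e & forall x y, K x -> `|x - y| < e -> A y.
Proof.
move=> cK oA KA; have /compact_bounded[B [_ HB]] := cK.
have KB x : K x -> `|x| <= `|B| + 1 by apply: HB; rewrite (le_lt_trans (ler_norm _)) // ltrDl.
(* Only the part of the complement within distance 1 of [K] matters, and it lies in a compact
   ball. *)
have cL : compact (cball 0 (`|B| + 2) `&` ~` A).
  apply: (subclosed_compact _ (@cball_compact R 0 (`|B| + 2))) => //.
  apply: closedI; last by rewrite closedC.
  by apply: compact_closed; [exact: norm_hausdorff|exact: cball_compact].
have [|d d0 Hd] := compact_dist_pos cK cL; first by move=> x /KA Ax [].
exists (Num.min d 1) => [|x y Kx]; first by rewrite lt_min d0 ltr01.
rewrite lt_min => /andP[xyd xy1]; apply: contrapT => Ay.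
have := Hd x y Kx; rewrite leNgt xyd => H; have // := H _.
apply: False_ind; apply: notF; apply: H; split => //.
rewrite /cball /= sub0r normrN.
rewrite -[y](subKr x) (le_trans (ler_normB _ _)) //.
by have := KB _ Kx; lra.
Qed.

Section Levels.
Variable R : realType.
Local Notation P := (R * R)%type.
Local Notation T := (int * int * int)%type.
Variables (G : T -> P -> P) (r : P) (C : R) (b : bool).
Hypothesis HG : plane_action G r C.
Variables (M : R) (U V : R -> set P).
Hypothesis HB : barriers G r b M U V.

Local Notation rotc := (rotc r b).

Lemma rotcD g h : rotc (g + h) = rotc g + rotc h.
Proof. by rewrite /rotc rotvD crdD. Qed.

Lemma rotcN g : rotc (- g) = - rotc g.
Proof. by rewrite /rotc rotvN; case: (b). Qed.

Lemma rotcMz g k : rotc (g *~ k) = k%:~R * rotc g.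
Proof.
have nat_case (n : nat) : rotc (g *+ n) = n%:R * rotc g.
  by elim: n => [|n IH]; rewrite ?mulr0n ?mul0r ?mulrS ?rotcD ?IH /rotc ?rotv0; [case: (b)|ring].
by case: k => n; rewrite ?NegzE ?mulrNz ?rotcN nat_case ?rmorphN ?mulNr.
Qed.

Lemma rotc_neq0 g : g.1.1 != 0 -> rotc g != 0.
Proof.
case: g => [[n p] q] /= n0; apply/eqP; rewrite /rotc /rotv /crd /=.
case: (b); rewrite /GRing.scale /= => E.
  have [|_ n00 _] := @act_irr _ _ _ _ HG 0 n q; first by rewrite mul0r add0r.
  by rewrite n00 eqxx in n0.
have [|n00 _ _] := @act_irr _ _ _ _ HG n 0 p; first by rewrite mul0r addr0.
by rewrite n00 eqxx in n0.
Qed.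

Definition Hp x := inf [set s | U s x].
Definition Hm x := sup [set t | V t x].

Let Uset x : [set s | U s x] !=set0 /\ has_lbound [set s | U s x].
Proof.
split; first by exists (crd b x + 1); apply: (bar_lowl HB); rewrite ltrDl.
by exists (crd b x - M) => s /(bar_upl HB); lra.
Qed.

Let Vset x : [set t | V t x] !=set0 /\ has_ubound [set t | V t x].
Proof.
split; first by exists (crd b x - M - 1); apply: (bar_upr HB); lra.
by exists (crd b x) => s /(bar_lowr HB).
Qed.

Lemma Hp_lt x s : Hp x < s -> U s x.
Proof.
move=> /(inf_lt (Uset x).1)[s' Us' /ltW s's]; exact: (bar_monol HB s's).
Qed.

Lemma Hp_le x s : U s x -> Hp x <= s.
Proof. by move=> Us; apply: ge_inf => //; exact: (Uset x).2. Qed.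

Lemma Hm_gt x t : t < Hm x -> V t x.
Proof.
move=> /(sup_gt (Vset x).1)[s' Vs' /ltW s's]; exact: (bar_monor HB s's).
Qed.

Lemma Hm_ge x t : V t x -> t <= Hm x.
Proof. by move=> Vt; apply: ub_le_sup => //; exact: (Vset x).2. Qed.

Lemma Hm_le_Hp x : Hm x <= Hp x.
Proof.
rewrite leNgt; apply/negP => lt; pose s := (Hm x + Hp x) / 2.
have Us : U s x by apply: Hp_lt; rewrite /s; lra.
have Vs : V s x by apply: Hm_gt; rewrite /s; lra.
exact: (bar_disj HB) Us Vs.
Qed.

Lemma Hp_act g x : Hp (G g x) = Hp x + rotc g.
Proof.
have le h y : Hp (G h y) <= Hp y + rotc h.
  apply/ler_addgt0Pr => e e0; rewrite addrAC; apply: Hp_le.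
  by apply: (bar_actl HB); apply: Hp_lt; rewrite ltrDl.
apply/eqP; rewrite eq_le le /=.
by have := le (- g) (G g x); rewrite (actK HG) rotcN; lra.
Qed.

Lemma Hm_act g x : Hm (G g x) = Hm x + rotc g.
Proof.
have le h y : Hm y + rotc h <= Hm (G h y).
  apply/ler_addgt0Pr => e e0; rewrite -lerBlDr addrAC; apply: Hm_ge.
  by apply: (bar_actr HB); apply: Hm_gt; rewrite ltrBlDr ltrDl.
apply/eqP; rewrite eq_le le andbT.
by have := le (- g) (G g x); rewrite (actK HG) rotcN; lra.
Qed.

(** This is the upper semicontinuity of [Hp] together with the lower semicontinuity of [Hm]. *)
Lemma levels_near x e : 0 < e -> exists2 d, 0 < d &
  forall y, `|x - y| < d -> U (Hp x + e) y /\ V (Hm x - e) y.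
Proof.
move=> e0.
have /openP_norm/(_ x)[|d1 d10 H1] := bar_openl HB (s := Hp x + e).
  by apply: Hp_lt; rewrite ltrDl.
have /openP_norm/(_ x)[|d2 d20 H2] := bar_openr HB (s := Hm x - e).
  by apply: Hm_gt; rewrite ltrBlDr ltrDl.
exists (Num.min d1 d2) => [|y]; first by rewrite lt_min d10.
by rewrite lt_min => /andP[/H1 ? /H2 ?].
Qed.

Definition gap x := Hp x - Hm x.

Lemma U_nonempty t : U t !=set0.
Proof.
exists (t - 1, t - 1); apply: (bar_lowl HB).
by rewrite (_ : crd b _ = t - 1) ?ltrBlDr ?ltrDl //; case: (b).
Qed.

Let separated t s := forall z, closure (U t) z -> ~ closure (V s) z.

Let half_left t S : U t `<=` S -> exists N, forall x, crd b x < N -> S x.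
Proof. by move=> US; exists t => x /(bar_lowl HB) /US. Qed.

Let half_right s S : V s `<=` S -> exists N, forall x, N < crd b x -> S x.
Proof. by move=> VS; exists (s + M) => x /(bar_upr HB) /VS. Qed.

(* A point between [V t] and [U s] would lie in a component of the complement of
   [closure (V s)] that either meets [U t], hence is part of [U s], or can be
   attached to [V s] without touching [closure (U t)], hence is part of [V t]. *)
Lemma gap_le L : 0 <= L -> (forall t s, L < s - t -> separated t s) ->
  forall x, gap x <= L.
Proof.
move=> L0 sep x; rewrite leNgt; apply/negP; rewrite /gap => Lx.
pose d := (Hp x - Hm x - L) / 4; have d0 : 0 < d by rewrite /d; lra.
pose t := Hm x + d; pose s := Hp x - d.
have Lst : L < s - t by rewrite /s /t /d; lra.
have ts : t <= s by lra.
have nUs : ~ U s x by move=> /Hp_le; rewrite /s; lra.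
have nVt : ~ V t x by move=> /Hm_ge; rewrite /t; lra.
have sepst := sep t s Lst.
have V_far y : V s y -> ~ closure (U t) y.
  apply: open_disjoint_closure; first exact: (bar_openr HB).
  by move=> z /(bar_monor HB ts) Vz Uz; exact: (bar_disj HB) Uz Vz.
have U_far y : U t y -> ~ closure (V s) y.
  apply: open_disjoint_closure; first exact: (bar_openl HB).
  by move=> z /(bar_monol HB ts) Uz Vz; exact: (bar_disj HB) Uz Vz.
(* A small ball about [y] avoids [closure (U t)] and links [S] to [V s]; maximality then puts [S],
   and so [x], inside [V t]. *)
have attach y S : closure (V s) y -> connected S -> (forall z, S z -> ~ closure (U t) z) ->
    closure S y -> S x -> False.
  move=> Vy cS SU Sy Sx; apply: nVt.
  have ny : ~ closure (U t) y by move=> /sepst.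
  have /openP_norm/(_ y ny)[e e0 He] : open (~` closure (U t)).
    by rewrite openC; exact: closed_closure.
  have [v Vv yv] := proj1 (closureP_norm _ _) Vy e e0.
  have [z Sz yz] := proj1 (closureP_norm _ _) Sy e e0.
  suff : (S `|` [set u | `|y - u| < e]) `|` V s `<=` V t by apply; left; left.
  apply: (bar_maxr HB).
  - apply: connectedU; [by exists v; split; first right| |exact: (bar_connectedr HB)].
    by apply: connectedU => //; [by exists z|exact: ball_connected].
  - by move=> u [[/SU//|/He//]|/V_far].
  - by apply: (@half_right s); move=> u; right.
have nVs : ~ closure (V s) x.
  move=> Vx; apply: (attach x [set x]) => //; first exact: connected1.
    by move=> z ->; move=> /sepst.
  exact: subset_closure.
pose O := connected_component (~` closure (V s)) x.
have oV : open (~` closure (V s)) by rewrite openC; exact: closed_closure.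
have oO : open O by exact: open_component.
have Ox : O x by exact: connected_component_refl.
have OU y : O y -> ~ U t y.
  move=> Oy Uy; apply: nUs.
  suff : O `|` U t `<=` U s by apply; left.
  apply: (bar_maxl HB).
  - apply: connectedU; [by exists y|exact: component_connected|exact: (bar_connectedl HB)].
  - by move=> z [/connected_component_sub|/U_far].
  - by apply: (@half_left t); move=> u; right.
have OU' := open_disjoint_closure oO OU.
(* The component [O] misses [U t], so it is not the whole plane; its boundary points lie in
   [closure (V s)]. *)
have [y [clOy nOy]] : exists y, closure O y /\ ~ O y.
  apply: contrapT => Hno.
  have : [set: P] `<=` O.
    apply: connected_subset_open => //; [exact: plane_connected|by exists x|].
    by move=> z _ clz; apply: contrapT => nOz; apply: Hno; exists z.
  by have [u Uu] := U_nonempty t; move=> /(_ u I) /OU.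
apply: (attach y O) => //; last exact: component_connected.
by apply: contrapT => nVy; apply: nOy; exact: closure_component.
Qed.

(** Translation in the coordinate other than [b], that is, around the annulus; it leaves all levels
    unchanged. *)
Definition across (k : int) : T := if b then (0, k, 0) else (0, 0, k).

Definition avec (k : int) : P := if b then vec R k 0 else vec R 0 k.

Lemma act_across k x : G (across k) x = x + avec k.
Proof. by rewrite /across /avec; case: (b); rewrite (act_translation HG). Qed.

Lemma crd_avec k : crd b (avec k) = 0.
Proof. by rewrite /avec; case: (b). Qed.

Lemma crdN_avec k : crd (~~ b) (avec k) = k%:~R.
Proof. by rewrite /avec; case: (b). Qed.

Lemma rotc_across k : rotc (across k) = 0.
Proof.
by rewrite /rotc /rotv /across; case: (b); rewrite /= scale0r add0r.
Qed.

(* A loop around the annulus in [U s `&` V t] separates [U t] from [V s]. *)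
Lemma loop_separates t s w (k : int) : k != 0 ->
  joined (U s `&` V t) w (G (across k) w) -> separated t s.
Proof.
move=> k0 [K0 [cK0 coK0 K0A K0w K0w']] z clU clV.
have shift j x : U s (x + avec j) -> U s x.
  rewrite -act_across => /(bar_actl HB (- across j)).
  by rewrite (actK HG) rotcN rotc_across oppr0 addr0.
have shiftV j x : V t (x + avec j) -> V t x.
  rewrite -act_across => /(bar_actr HB (- across j)).
  by rewrite (actK HG) rotcN rotc_across oppr0 addr0.
(* All horizontal copies of the loop, with [b] taken as the vertical coordinate; they remain between
   the same levels. *)
pose A := [set x | exists j : int, K0 (x + avec j)].
have AU x : A x -> U s x by move=> [j /K0A[/shift]].
have AV x : A x -> V t x by move=> [j /K0A[_ /shiftV]].
have [e e0 He] := compact_nbhd cK0 (bar_openl HB (s := s)) (fun x Kx => (K0A x Kx).1).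
have e20 : 0 < e / 2 by lra.
have [u Uu zu] := proj1 (closureP_norm _ _) clU _ e20.
have [v Vv zv] := proj1 (closureP_norm _ _) clV _ e20.
pose B := [set x | `|z - x| < e / 2].
have BA x : B x -> ~ A x.
  move=> zx [j Kx]; apply: (bar_disj HB) Vv; apply: (shift j); apply: He Kx _.
  rewrite opprD addrACA subrr addr0.
  rewrite (le_lt_trans (ler_distD z _ _)) // (distrC x z).
  by move: zx; rewrite /B /=; lra.
(* If the closures met at [z], a small ball about [z] would connect [U t] to [V s] without touching
   [A]: a point of [A] in it would force the nearby [v] into [U s]. *)
pose S := (U t `|` B) `|` V s.
have SA x : S x -> ~ A x.
  move=> [[Ux|/BA//]|Vx] Ax; first exact: (bar_disj HB) Ux (AV x Ax).
  exact: (bar_disj HB) (AU x Ax) Vx.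
have oS : open S.
  by apply: openU; [apply: openU; [exact: (bar_openl HB)|exact: ball_open]|exact: (bar_openr HB)].
have cS : connected S.
  apply: connectedU; [by exists v; split; first right| |exact: (bar_connectedr HB)].
  apply: connectedU; [by exists u|exact: (bar_connectedl HB)|exact: ball_connected].
have [m m0 Hm] : exists2 m : R, 0 <= m & forall x, A x -> `|crd b x| <= m.
  have /compact_bounded[m [_ Hm]] := cK0.
  exists (`|m| + 1) => [|x [j Kx]]; first by rewrite addr_ge0.
  have -> : crd b x = crd b (x + avec j) by rewrite crdD crd_avec addr0.
  apply: le_trans (norm_crd _ _) _; apply: Hm => //.
  by rewrite (le_lt_trans (ler_norm _)) // ltrDl.
pose a : P := (- (m + 1 + `|t|), - (m + 1 + `|t|)).
pose c : P := (m + 1 + `|s| + `|M|, m + 1 + `|s| + `|M|).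
have ca : crd b a = - (m + 1 + `|t|) by rewrite /a; case: (b).
have cc : crd b c = m + 1 + `|s| + `|M| by rewrite /c; case: (b).
have Sa : S a.
  left; left; apply: (bar_lowl HB); rewrite ca.
  by have := ler_norm (- t); rewrite normrN; lra.
have Sc : S c.
  right; apply: (bar_upr HB); rewrite cc.
  by have := ler_norm s; have := ler_norm M; lra.
have [K [cK coK KS Ka Kc]] := open_connected_joined oS cS Sa Sc.
have /compact_bounded[q [_ Hq]] := cK.
have {}Hq x : K x -> `|crd (~~ b) x| <= `|q| + 1.
  move=> Kx; apply: le_trans (norm_crd _ _) _; apply: Hq => //.
  by rewrite (le_lt_trans (ler_norm _)) // ltrDl.
have avecD i j : avec (i + j) = avec i + avec j.
  by rewrite /avec /vec; case: (b); rewrite intrD; congr (_, _); rewrite addr0.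
have avec0 : avec 0 = 0 by rewrite /avec; case: (b).
have avecN j : avec (- j) = - avec j.
  by apply: (addIr (avec j)); rewrite -avecD !addNr avec0.
have wwk : joined A w (w + avec k).
  by exists K0; split; rewrite -?act_across // => x Kx; exists 0; rewrite avec0 addr0.
have Ashift j x : A x -> A (x + avec j).
  by move=> [i Kx]; exists (i - j); rewrite -addrA -avecD addrCA subrr addr0.
have joined_shift j x y : joined A x y -> joined A (x + avec j) (y + avec j).
  rewrite -!act_across; apply: joined_image; first exact: (@act_continuous _ _ _ _ HG (across j)).
  by move=> _ [x' Ax' <-]; rewrite act_across; exact: Ashift.
have up (i : nat) x : joined A x (x + avec k) -> joined A x (x + avec (k *+ i)).
  move=> xx; elim: i => [|i IH].
    by rewrite mulr0n avec0 addr0; apply: joined_refl; case: xx => L [_ _ LA Lx _]; exact: LA.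
  by apply: joined_trans IH _; rewrite mulrS avecD addrA; exact: joined_shift.
(* Enough copies of the loop in both directions outrun the extent of [K], so that [crossing] applies
   to [K] and a continuum in [A]. *)
have [i Hi] : exists i : nat, `|q| + 1 + `|w| < i%:R.
  by exists (Num.bound (`|q| + 1 + `|w|)); apply: archi_boundP; rewrite !addr_ge0.
have both : joined A (w + avec (- (k *+ i))) (w + avec (k *+ i)).
  apply: joined_trans (up i w wwk).
  rewrite -{2}[w](addrNK (avec (k *+ i))) -avecN.
  by apply: up; rewrite addrAC; exact: joined_shift.
have ki : i%:R <= `|k%:~R * i%:R : R|.
  rewrite normrM normr_nat ler_peMl // -intr_norm (_ : 1 = 1%:~R) // ler_int.
  by rewrite -gtz0_ge1 normr_gt0.
have hw := norm_crd (~~ b) w.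
have hgt j : crd (~~ b) (w + avec j) = crd (~~ b) w + j%:~R by rewrite crdD crdN_avec.
have [x [y [[L [cL coL LA Lx Ly]] HK]]] : exists x y, joined A x y /\
    forall o, K o -> crd (~~ b) x < crd (~~ b) o < crd (~~ b) y.
  have [k_gt0|k_le0] := ltrP 0 k.
    exists (w + avec (- (k *+ i))), (w + avec (k *+ i)); split => // o /Hq.
    move: ki; rewrite !hgt rmorphN rmorphMn /= -mulr_natr.
    rewrite ger0_norm ?mulr_ge0 ?ler0z ?(ltW k_gt0) //.
    by move: hw => /ler_normlP[? ?] ? /ler_normlP[? ?]; apply/andP; split; lra.
  exists (w + avec (k *+ i)), (w + avec (- (k *+ i))); split; first exact: joined_sym.
  move=> o /Hq.
  move: ki; rewrite !hgt rmorphN rmorphMn /= -mulr_natr.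
  rewrite ler0_norm ?mulr_le0_ge0 ?lerz0 //.
  by move: hw => /ler_normlP[? ?] ? /ler_normlP[? ?]; apply/andP; split; lra.
have [||o [Ko Lo]] := @crossing _ b K L a c x y cK coK cL coL Ka Kc Lx Ly.
- move=> o /LA/Hm /ler_normlP[? ?]; rewrite ca cc.
  have := normr_ge0 t; have := normr_ge0 s; have := normr_ge0 M.
  by move=> ? ? ?; apply/andP; split; lra.
- exact: HK.
exact: SA (KS _ Ko) (LA _ Lo).
Qed.

End Levels.

(** * Constancy of the gap *)

Section Walk.
Variables (R : realType) (T : zmodType) (f : T -> R).
Hypotheses (fD : forall g h, f (g + h) = f g + f h).

(* Taking a step of nonnegative weight when the current height is nonpositive, and
   conversely, keeps all partial sums within the maximal step. *)
Lemma bounded_walk (mu : R) (Q : T -> Prop) (l : seq T) (h : T) :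
  (forall g, g \in l -> `|f g| <= mu) ->
  (forall k g, g \in l -> Q k -> `|f k| <= mu -> `|f (k + g)| <= mu -> Q (k + g)) ->
  Q h -> `|f h| <= mu -> f (h + \sum_(g <- l) g) = 0 -> Q (h + \sum_(g <- l) g).
Proof.
have f0 : f 0 = 0 by apply: (addIr (f 0)); rewrite -fD !add0r.
have fS (s : seq T) : f (\sum_(g <- s) g) = \sum_(g <- s) f g.
  by elim: s => [|g s IH]; rewrite ?big_nil // !big_cons fD IH.
have [n] := ubnP (size l); elim: n l h => // n IH [|g0 l0] h sn lmu Qstep Qh hmu sum0.
  by rewrite big_nil addr0.
set l := g0 :: l0 in sn lmu Qstep sum0 *.
(* If every remaining weight pushed the height away from 0, the final height could not vanish. *)
have [g gl good] : exists2 g, g \in l & `|f (h + g)| <= mu.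
  have [fh|fh] := lerP (f h) 0.
    have [/hasP[g gl g0']|/hasPn Hno] := boolP (has (fun g => 0 <= f g) l).
      exists g => //; have := lmu g gl; move: hmu; rewrite fD.
      by move=> /ler_normlP[? ?] /ler_normlP[? ?]; apply/ler_normlP; split; lra.
    have neg g : g \in l -> f g < 0 by move=> /Hno; rewrite -ltNge.
    have : f h + \sum_(g <- l) f g < 0.
      rewrite big_cons; have := neg g0 (mem_head _ _).
      suff : \sum_(g <- l0) f g <= 0 by lra.
      rewrite big_seq; apply: sumr_le0 => g gl0; apply/ltW/neg.
      by rewrite inE gl0 orbT.
    by rewrite -fS -fD sum0 ltxx.
  have [/hasP[g gl g0']|/hasPn Hno] := boolP (has (fun g => f g <= 0) l).
    exists g => //; have := lmu g gl; move: hmu; rewrite fD.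
    by move=> /ler_normlP[? ?] /ler_normlP[? ?]; apply/ler_normlP; split; lra.
  have pos g : g \in l -> 0 < f g by move=> /Hno; rewrite -ltNge.
  have : 0 < f h + \sum_(g <- l) f g.
    suff : 0 <= \sum_(g <- l) f g by lra.
    by rewrite big_seq; apply: sumr_ge0 => g gl0; exact/ltW/pos.
  by rewrite -fS -fD sum0 ltxx.
have E : h + \sum_(k <- l) k = h + g + \sum_(k <- rem g l) k.
  by rewrite (perm_big _ (perm_to_rem gl)) big_cons addrA.
rewrite E in sum0 *; apply: IH => //.
- by rewrite size_rem // prednK.
- by move=> k /mem_rem; exact: lmu.
- by move=> k g' /mem_rem; exact: Qstep.
- exact: Qstep.
Qed.

End Walk.

(** * Independent returns and the infimum of the gap *)

Section Invariance.
Variable R : realType.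
Local Notation P := (R * R)%type.
Local Notation T := (int * int * int)%type.
Variables (G : T -> P -> P) (r : P) (C : R) (W : set P) (b : bool).
Hypotheses (HG : plane_action G r C) (HW : small_domains W).
Hypotheses (oW : open W) (WG : forall g z, W z -> W (G g z)).
Hypothesis NW : forall w, ~ W w -> forall (e : R) (N : nat), 0 < e ->
  exists u g, [/\ `|w - u| < e, `|w - G g u| < e & (N <= `|g.1.1|)%N].

Local Notation rotc := (rotc r b).

(* Along a rational plane of [T] the rotation vector grows linearly in [g.1.1]. *)
Lemma escapes_rational_plane (c : T) (B : R) : c != 0 -> exists N : nat, forall g : T,
  (N <= `|g.1.1|)%N -> `|rotv r g| <= B -> c.1.1 * g.1.1 + c.1.2 * g.1.2 + c.2 * g.2 != 0.
Proof.
case: c => [[c0 c1] c2] /= c_neq0.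
(* On the plane orthogonal to [c], the combination of the coordinates of [rotv r g] with weights
   [c1], [c2] equals [g.1.1] times [k], and [k] is nonzero by [act_irr]. *)
pose k : R := c1%:~R * r.1 + c2%:~R * r.2 - c0%:~R.
have k0 : 0 < `|k|.
  rewrite normr_gt0; apply/eqP => E; move/eqP: c_neq0; apply.
  have [|-> -> /eqP] := @act_irr _ _ _ _ HG c1 c2 (- c0); first by rewrite rmorphN.
  by rewrite oppr_eq0 => /eqP ->.
pose D : R := (`|c1%:~R| + `|c2%:~R|) * B / `|k|.
exists (Num.bound `|D|) => -[[n p] q] /= nN gB; apply/negP => /eqP.
move=> /(congr1 (fun i : int => i%:~R : R)); rewrite !rmorphD !rmorphM /= mulr0z => E.
have : n%:~R * k = c1%:~R * (rotv r (n, p, q)).1 + c2%:~R * (rotv r (n, p, q)).2.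
  by rewrite /rotv /vec /k /= /GRing.scale /= -[LHS]addr0 -E; ring.
move/(congr1 Num.norm); rewrite normrM => Ek.
have : `|n%:~R : R| * `|k| <= (`|c1%:~R| + `|c2%:~R|) * B.
  rewrite Ek mulrDl (le_trans (ler_normD _ _)) // !normrM.
  by move: gB; rewrite norm_le => /andP[gB1 gB2]; apply: lerD; exact: ler_wpM2l.
rewrite -ler_pdivlMr // -/D; apply/negP; rewrite -ltNge.
rewrite (le_lt_trans (ler_norm _)) // (lt_le_trans (archi_boundP (normr_ge0 _))) //.
by rewrite -intr_norm -abszE -[X in _ <= X]pmulrn ler_nat.
Qed.

Definition returns w (e : R) g := exists u, [/\ ~ W u, `|w - u| < e & `|w - G g u| < e].

Lemma returns_bound w e g : returns w e g -> `|rotv r g| <= C + 2 * e.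
Proof.
move=> [u [_ wu wgu]].
rewrite -[rotv r g](subKr (G g u - u)) (le_trans (ler_normB _ _)) //.
have := act_dev HG g u; have := ler_distD w (G g u) u.
rewrite (distrC (G g u) w); lra.
Qed.

(** Each return is chosen outside a rational plane containing the previous ones; Cramer's rule then
    produces a multiple of a basis vector. *)
Lemma three_returns w e : ~ W w -> 0 < e -> exists (g1 g2 g3 : T) (a1 a2 a3 k : int),
  [/\ returns w e g1, returns w e g2, returns w e g3, g1.1.1 != 0 &
   k != 0 /\ g1 *~ a1 + g2 *~ a2 + g3 *~ a3 = across b k].
Proof.
move=> Ww e0.
have escape c N : c != 0 -> exists2 g : T, returns w e g /\ (N <= `|g.1.1|)%N &
    c.1.1 * g.1.1 + c.1.2 * g.1.2 + c.2 * g.2 != 0.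
  move=> c0; have [N' HN'] := escapes_rational_plane (C + 2 * e) c0.
  have [u [g [Wu wu wgu]]] := nonwandering_restricted HG HW oW WG NW (maxn N N') Ww e0.
  rewrite geq_max => /andP[Ng N'g].
  have Hg : returns w e g by exists u.
  by exists g => //; apply: HN' => //; exact: returns_bound Hg.
have [[[n1 p1] q1] /= [r1 n1_gt0] _] := escape (1, 0, 0) 1%N isT.
have n1_neq0 : n1 != 0 by rewrite -absz_gt0.
have [|[[n2 p2] q2] /= [r2 _] h2] := escape (p1, - n1, 0) 0%N.
  by apply/eqP => -[_ /eqP]; rewrite oppr_eq0 (negbTE n1_neq0).
(* The cross product of the first two returns, nonzero by [h2]; below, [k] is the determinant and
   the coefficients are cofactors. *)
pose c := (p1 * q2 - q1 * p2, q1 * n2 - n1 * q2, n1 * p2 - p1 * n2).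
have [|[[n3 p3] q3] /= [r3 _] h3] := escape c 0%N.
  apply/eqP => -[_ _ /eqP]; apply/negP; move: h2.
  by apply: contraNN => /eqP E; rewrite -oppr_eq0; apply/eqP; rewrite -[RHS]E; ring.
have mulzE n p q a : (n, p, q) *~ a = (n * a, p * a, q * a) :> T.
  have nat_case (m : nat) : (n, p, q) *+ m = (n * m%:Z, p * m%:Z, q * m%:Z) :> T.
    elim: m => [|m IH]; first by rewrite mulr0n !mulr0.
    by rewrite mulrS IH; congr (_, _, _); rewrite /= intS mulrDr mulr1.
  case: a => m; rewrite ?NegzE ?mulrNz -pmulrn nat_case //.
  by congr (_, _, _); rewrite /= mulrN.
pose k := c.1.1 * n3 + c.1.2 * p3 + c.2 * q3.
case Eb: b.
  exists (n1, p1, q1), (n2, p2, q2), (n3, p3, q3), (q2 * n3 - n2 * q3),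
    (q3 * n1 - n3 * q1), (q1 * n2 - n1 * q2), k; split => //; split => //.
  rewrite !mulzE /across; congr (_, _, _); rewrite /k /c /=; ring.
exists (n1, p1, q1), (n2, p2, q2), (n3, p3, q3), (n2 * p3 - p2 * n3),
  (n3 * p1 - p3 * n1), (n1 * p2 - p1 * n2), k; split => //; split => //.
rewrite !mulzE /across; congr (_, _, _); rewrite /k /c /=; ring.
Qed.

Section Separation.
Variables (M : R) (U V : R -> set P).
Hypothesis HB : barriers G r b M U V.

Local Notation Hp := (Hp U).
Local Notation Hm := (Hm V).
Local Notation gap := (gap U V).

Let g0 := inf [set gap w | w in ~` W].

Let gap_ge0 x : 0 <= gap x.
Proof. by rewrite subr_ge0; exact: (Hm_le_Hp HB). Qed.

Let gap_set : [set gap w | w in ~` W] !=set0 /\ has_lbound [set gap w | w in ~` W].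
Proof.
split; last by exists 0 => _ [w _ <-]; exact: gap_ge0.
have [W0|W0] := pselect (W 0); last by exists (gap 0), 0.
by have [y _ Wy] := component_boundary HW oW W0; exists (gap y), y.
Qed.

Let g0_le w : ~ W w -> g0 <= gap w.
Proof. by move=> Ww; apply: ge_inf; [exact: gap_set.2|exists w]. Qed.

Let g0_ge0 : 0 <= g0.
Proof. by apply: lb_le_inf; [exact: gap_set.1|move=> _ [w _ <-]; exact: gap_ge0]. Qed.

(** The images of the ball about [w] under [h] and [h + g] are continua between the required levels,
    and both contain [G (h + g) u]. *)
Lemma joined_step w e t s t' s' mu g h :
  (forall y, `|w - y| <= e -> U s y /\ V t y) -> 0 <= e -> s + mu <= s' -> t' + mu <= t ->
  returns w e g -> `|rotc h| <= mu -> `|rotc (h + g)| <= mu ->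
  joined (U s' `&` V t') (G h w) (G (h + g) w).
Proof.
move=> UV e0 ss' tt' [u [_ wu wgu]] hmu hgmu.
have box k : `|rotc k| <= mu -> G k @` (cball w e) `<=` U s' `&` V t'.
  move=> /ler_normlP[k1 k2] _ [y /UV[Uy Vy] <-]; split.
    by apply: (bar_monol HB) (bar_actl HB k Uy); lra.
  by apply: (bar_monor HB) (bar_actr HB k Vy); lra.
have in_box y : `|w - y| <= e -> joined (cball w e) w y.
  move=> wy; exists (cball w e); split => //; [exact: cball_compact|exact: cball_connected|].
  by rewrite /cball /= subrr normr0.
have cG k := @act_continuous _ _ _ _ HG k.
apply: joined_trans (joined_image (cG h) (box h hmu) (in_box _ (ltW wgu))) _.
rewrite -(actD HG); apply: joined_sym.
exact: joined_image (cG (h + g)) (box _ hgmu) (in_box _ (ltW wu)).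
Qed.

Lemma closures_separated t s : g0 < s - t -> forall z, closure (U t) z -> ~ closure (V s) z.
Proof.
move=> st; pose e := (s - t - g0) / 20.
have e0 : 0 < e by rewrite /e; lra.
have [_ [w Ww <-] gapw] : exists2 y, [set gap w | w in ~` W] y & y < g0 + e.
  by apply: inf_lt; [exact: gap_set.1|rewrite ltrDl].
have [d d0 Hd] := levels_near HB w e0.
have d20 : 0 < d / 2 by lra.
have UV y : `|w - y| <= d / 2 -> U (Hp w + e) y /\ V (Hm w - e) y by move=> ?; apply: Hd; lra.
have [g1 [g2 [g3 [a1 [a2 [a3 [k [r1 r2 r3 g1n [k0 sumE]]]]]]]]] := three_returns Ww d20.
pose mu := 3 * e.
have mu0 : 0 <= mu by rewrite /mu; lra.
(* Both ends of a return have [Hp] at most [Hp w + e]. As their gaps are at least [g0], with [gap w]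
   below [g0 + e], they also have [Hp] at least [Hp w - 2 * e]. *)
have small g : returns w (d / 2) g -> `|rotc g| <= mu.
  move=> [u [Wu /ltW/UV[Uu Vu] /ltW/UV[Ug Vg]]].
  move: (Hp_le HB Ug) (Hm_ge HB Vg) (Hp_le HB Uu) (Hm_ge HB Vu).
  rewrite (Hp_act HG HB) (Hm_act HG HB); have := g0_le Wu; move: gapw.
  by rewrite /mu /gap => *; apply/ler_normlP; split; lra.
pose s1 := Hp w + e + mu; pose t1 := Hm w - e - mu.
pose Q h := joined (U s1 `&` V t1) w (G h w).
have stepQ g h : returns w (d / 2) g -> Q h -> `|rotc h| <= mu ->
    `|rotc (h + g)| <= mu -> Q (h + g).
  move=> rg Qh h1 h2; apply: joined_trans Qh _.
  by apply: (joined_step UV _ _ _ rg h1 h2); [exact: ltW| |rewrite subrK].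
have stepQN g h : returns w (d / 2) g -> Q h -> `|rotc h| <= mu ->
    `|rotc (h - g)| <= mu -> Q (h - g).
  move=> rg Qh h1 h2; apply: joined_trans Qh _; apply: joined_sym.
  rewrite -{2}(subrK g h); apply: (joined_step UV _ _ _ rg h2); rewrite ?subrK //; exact: ltW.
pose signed (g : T) (a : int) : seq T := nseq `|a| (if 0 <= a then g else - g).
have signedE (g : T) (a : int) : \sum_(h <- signed g a) h = g *~ a.
  rewrite big_nseq -Monoid.iteropE -/(GRing.natmul _ _).
  case: a => n /=; first by rewrite pmulrn.
  by rewrite NegzE mulrNz mulNrn pmulrn.
pose l := signed g1 a1 ++ signed g2 a2 ++ signed g3 a3.
have lP (g : T) : g \in l -> exists2 h, returns w (d / 2) h & g = h \/ g = - h.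
  rewrite !mem_cat !mem_nseq => /orP[/andP[_ /eqP->]|/orP[]/andP[_ /eqP->]];
    [exists g1|exists g2|exists g3] => //; case: ifP => _; by [left|right].
have Qk : Q (0 + \sum_(g <- l) g).
  apply: (@bounded_walk R _ rotc (rotcD r b) mu).
  - by move=> g /lP[h /small hs [->|->]] //; rewrite rotcN normrN.
  - by move=> h g /lP[g' rg [->|->]]; [exact: stepQ|exact: stepQN].
  - rewrite /Q (act0 HG); apply: joined_refl; split.
      by apply: (Hp_lt HB); rewrite /s1; lra.
    by apply: (Hm_gt HB); rewrite /t1; lra.
  - by rewrite /rotc rotv0 (_ : crd b 0 = 0) ?normr0 //; case: (b).
  - by rewrite add0r !big_cat /= !signedE addrA sumE rotc_across.
rewrite add0r !big_cat /= !signedE addrA sumE in Qk.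
have rg1 : 0 < `|rotc g1| by rewrite normr_gt0; exact: (rotc_neq0 b HG).
(* A multiple of [g1], whose step is nonzero and at most [3 * e], brings [s1] to within [3 * e]
   below [s]. Since [s1 - t1 < g0 + 9 * e] and [s - t = g0 + 20 * e], the level [t1] then lands
   above [t]. *)
have [h [h1 h2]] : exists h, t <= t1 + rotc h /\ s1 + rotc h <= s.
  pose q := (s - s1) / rotc g1.
  have cont j : s - s1 - 3 * e <= j%:~R * rotc g1 -> j%:~R * rotc g1 <= s - s1 ->
      exists h, t <= t1 + rotc h /\ s1 + rotc h <= s.
    move=> j1 j2; exists (g1 *~ j); rewrite rotcMz; split; last by lra.
    by move: j1 gapw; rewrite /t1 /s1 /mu /gap /e; lra.
  have := small _ r1; rewrite /mu => gs.
  have [gpos|gneg] := ltrP 0 (rotc g1).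
    have qE : q * rotc g1 = s - s1 by rewrite /q divfK // gt_eqF.
    apply: (cont (Num.floor q)); rewrite -qE; last by rewrite ler_pM2r // floor_le.
    have := floorD1_gt q; rewrite -(ltr_pM2r gpos) intrD1 mulrDl mul1r.
    by move: gs; rewrite gtr0_norm //; lra.
  have gneg' : rotc g1 < 0 by rewrite lt_neqAle gneg andbT -normr_gt0.
  have qE : q * rotc g1 = s - s1 by rewrite /q divfK // lt_eqF.
  apply: (cont (Num.floor q + 1)); rewrite -qE; last first.
    by rewrite ler_nM2r // ltW // floorD1_gt.
  have := floor_le q; rewrite -(ler_nM2r gneg') intrD1 mulrDl mul1r.
  by move: gs; rewrite ltr0_norm //; lra.
have loop : joined (U (s1 + rotc h) `&` V (t1 + rotc h)) (G h w) (G (across b k) (G h w)).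
  rewrite -(actD HG) (addrC (across b k)) (actD HG).
  apply: (joined_image (@act_continuous _ _ _ _ HG h)) Qk.
  by move=> _ [y [Uy Vy] <-]; split; [exact: (bar_actl HB)|exact: (bar_actr HB)].
move=> z Uz Vz; apply: (loop_separates HG HB k0 loop).
  exact: closureS (bar_monol HB h1) _ Uz.
exact: closureS (bar_monor HB h2) _ Vz.
Qed.

Lemma gap_le_g0 x : gap x <= g0.
Proof. exact: gap_le HB _ g0_ge0 closures_separated x. Qed.

Lemma gap_ge_g0 x : g0 <= gap x.
Proof.
rewrite leNgt; apply/negP => gx.
have Wx : W x by apply: contrapT => /g0_le; rewrite leNgt gx.
pose d := (g0 - gap x) / 4; have d0 : 0 < d by rewrite /d; lra.
pose s := Hp x + d; pose t := Hm x - d.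
have Us : U s x by apply: (Hp_lt HB); rewrite /s ltrDl.
have Vt : V t x by apply: (Hm_gt HB); rewrite /t ltrBlDr ltrDl.
have cxx : connected_component W x x by exact: connected_component_refl.
have [B HBd] := dom_bounded HW x.
(* [U s] and [V t] are connected and unbounded, so they reach the boundary of the
   bounded component of [x]. *)
have exit A : connected A -> A x -> (forall N, exists2 y, A y & N < `|y|) ->
    exists y, [/\ A y, closure (connected_component W x) y & ~ W y].
  move=> cA Ax unb; apply: contrapT => Hno.
  have : A `<=` connected_component W x.
    apply: connected_subset_open => //; [exact: open_component|by exists x|].
    move=> y Ay cly; apply: closure_component => //; apply: contrapT => Wy.
    by apply: Hno; exists y.
  have [y Ay yB] := unb B; move=> /(_ y Ay)/HBd.
  by rewrite leNgt yB.
have diag (v : R) : crd b (v, v) = v /\ v <= `|(v, v) : P|.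
  by split; [case: (b)|rewrite (le_trans (ler_norm v)) // prod_normE le_max lexx].
have [y [Vy cly Wy]] : exists y, [/\ V t y, closure (connected_component W x) y & ~ W y].
  apply: exit => //; first exact: (bar_connectedr HB).
  move=> N; pose v := `|N| + `|t + M| + 1.
  have [v1 v2] := diag v.
  exists (v, v); last by have := ler_norm N; have := normr_ge0 (t + M); rewrite /v in v2 *; lra.
  apply: (bar_upr HB); rewrite v1 /v.
  by have := ler_norm (t + M); have := normr_ge0 N; lra.
have [y' [Uy' cly' Wy']] : exists y, [/\ U s y, closure (connected_component W x) y & ~ W y].
  apply: exit => //; first exact: (bar_connectedl HB).
  move=> N; pose v := `|N| + `|s| + 1.
  have [v1 v2] := diag v; have [w1 w2] := diag (- v).
  have E : `|(- v, - v) : P| = `|(v, v) : P| by rewrite !prod_normE /= !normrN.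
  have Nv : N < v by rewrite /v; have := ler_norm N; have := normr_ge0 s; lra.
  have sv : - v < s.
    by rewrite /v; have := ler_norm (- s); rewrite normrN; have := normr_ge0 N; lra.
  exists (- v, - v); first by apply: (bar_lowl HB); rewrite w1.
  by rewrite E (lt_le_trans Nv).
(* The gaps at [y] and [y'] are at least [g0], so the difference is at least
   [2 * g0 - gap x - 2 * d], and [gap x = g0 - 4 * d]. *)
have far : g0 + 2 * d <= Hp y - Hm y'.
  have := g0_le Wy; have := g0_le Wy'; have := Hm_ge HB Vy; have := Hp_le HB Uy'.
  by rewrite /s /t /d /gap; lra.
pose u (n : nat) := G (bring r n) y.
pose K := cball (0 : P) (`|y| + C + 1).
have Ku n : K (u n).
  rewrite /K /cball /= sub0r normrN (le_trans (act_norm_le HG _ _)) // lerD2l.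
  exact: rotv_bring.
have [|p [_ clp]] := @cball_compact R 0 (`|y| + C + 1) (u @ \oo) _.
  by exists 0%N => // n _; exact: Ku.
have [|e e0 He] := levels_near HB p (e := d / 2); first by lra.
have e20 : 0 < e / 2 by lra.
have [N HN] := closure_component_shrinks HG HW WG Wx e20.
have [_ [[n /= Nn <-] pu]] : ([set u n | n in [set n | (N <= n)%N]] `&`
    [set q | `|p - q| < e / 2]) !=set0.
  apply: clp; first by exists N => // n Nn; exists n.
  by apply: open_nbhs_nbhs; split; [exact: ball_open|rewrite /= subrr normr0].
have yy' := HN (bring r n) Nn y y' cly cly'.
have [Up _] : U (Hp p + d / 2) (u n) /\ V (Hm p - d / 2) (u n) by apply: He; lra.
have [_ Vp] : U (Hp p + d / 2) (G (bring r n) y') /\ V (Hm p - d / 2) (G (bring r n) y').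
  by apply: He; rewrite (le_lt_trans (ler_distD (u n) _ _)) //; rewrite /u in pu *; lra.
(* Both levels are shifted by the same rotation, so [Hp y - Hm y' <= gap p + d <= g0 + d],
   contradicting [far]. *)
have := Hp_le HB Up; have := Hm_ge HB Vp.
rewrite (Hp_act HG HB) (Hm_act HG HB).
by have := gap_le_g0 p; rewrite /gap; lra.
Qed.

(** With a constant gap, [Hp] and [Hm] differ by a constant, so the two semicontinuities combine. *)
Lemma Hp_continuous x e : 0 < e -> exists2 d, 0 < d &
  forall y, `|x - y| < d -> `|Hp x - Hp y| <= e.
Proof.
move=> e0; have [d d0 Hd] := levels_near HB x e0; exists d => // y /Hd[Uy Vy].
have := Hp_le HB Uy; have := Hm_ge HB Vy.
have := gap_le_g0 x; have := gap_ge_g0 y; rewrite /gap => *.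
by apply/ler_normlP; split; lra.
Qed.

End Separation.

(** The bound in terms of [H] is a properness statement, from which the image of the semiconjugacy
    is later shown to be closed. *)
Lemma invariant_coordinate : exists (H : P -> R) (B : R),
  [/\ forall g x, H (G g x) = H x + rotc g, forall x, `|crd b x| <= `|H x| + B &
  forall x e, 0 < e -> exists2 d, 0 < d & forall y, `|x - y| < d -> `|H x - H y| <= e].
Proof.
have [M [U [V HB]]] := barriers_exist b HG.
exists (Hp U), `|M|; split; [exact: (Hp_act HG HB)| |exact: (Hp_continuous HB)].
move=> x; have up : Hp U x <= crd b x.
  by apply/ler_addgt0Pr => e e0; apply: (Hp_le HB); apply: (bar_lowl HB); rewrite ltrDl.
have low : crd b x - M <= Hp U x.
  apply/ler_addgt0Pr => e e0; have := bar_upl HB (Hp_lt HB (x := x) (s := Hp U x + e) _).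
  by rewrite ltrDl e0 => /(_ isT); lra.
have := ler_norm M; have := ler_norm (- M); rewrite normrN => ? ?.
have := ler_norm (Hp U x); have := ler_norm (- Hp U x); rewrite normrN => ? ?.
by apply/ler_normlP; split; lra.
Qed.

End Invariance.

(** * Lifts of torus homeomorphisms *)

Section TorusTopology.
Variable R : realType.
Local Notation P := (R * R)%type.
Local Notation vec := (@vec R).

Lemma tproj_eq (x y : P) : tproj x = tproj y <-> x - y \in @lattice R.
Proof.
have -> := @Quotient.idealrBE _ (@lattice R) x y.
by split=> [E|/eqP //]; exact/eqP.
Qed.

Lemma tproj_repr (x : torus R) : exists z, tproj z = x.
Proof. by exists (repr (x : Quotient.quot (@lattice R))); rewrite /tproj reprK. Qed.

Lemma translation_tproj r (z : P) : translation r (tproj z) = tproj (z + r).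
Proof. by rewrite /translation /tproj; symmetry; exact: (pi_addr z r). Qed.

Lemma tproj_continuous : continuous (@tproj R).
Proof. exact: pi_continuous. Qed.

Lemma latticeP (x : P) : reflect (exists m n, x = vec m n) (x \in @lattice R).
Proof.
apply: (iffP andP) => [[/intrP[m E1] /intrP[n E2]]|[m [n ->]]].
  by exists m, n; rewrite /vec -E1 -E2 -surjective_pairing.
by split; exact: intr_int.
Qed.

Lemma vecD m n m' n' : vec (m + m') (n + n') = vec m n + vec m' n'.
Proof. by rewrite /vec !intrD. Qed.

Lemma vecN m n : vec (- m) (- n) = - vec m n.
Proof. by rewrite /vec !rmorphN. Qed.

Lemma tprojP (x y : P) : tproj x = tproj y <-> exists m n, y = x + vec m n.
Proof.
rewrite tproj_eq; split => [/latticeP[m [n E]]|[m [n ->]]].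
  by exists (- m), (- n); rewrite vecN -E subKr.
by rewrite opprD addrA subrr add0r rpredN; apply/latticeP; exists m, n.
Qed.

Lemma tproj_vec (x : P) m n : tproj (x + vec m n) = tproj x.
Proof. by symmetry; apply/tprojP; exists m, n. Qed.

Lemma tproj_open (A : set P) : open A -> open (@tproj R @` A).
Proof.
move=> /openP_norm oA.
(* Openness in the quotient topology is openness of the preimage. *)
change (open (@tproj R @^-1` (@tproj R @` A))).
apply/openP_norm => x [a Aa /tprojP[m [n ->]]]; have [e e0 He] := oA a Aa.
exists e => // y xy; exists (y - vec m n); last by rewrite -vecN tproj_vec.
by apply: He; rewrite opprD addrA opprK addrAC.
Qed.

Lemma lattice_small (x : P) : x \in @lattice R -> `|x| < 1 -> x = 0.
Proof.
have small (k : int) : `|k| < 1 -> k = 0 by lia.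
move=> /latticeP[m [n ->]]; rewrite norm_lt /vec /= -!intr_norm.
by rewrite -[1]/(1%:~R) !ltr_int => /andP[/small-> /small->].
Qed.

(** Nearby values differ by a lattice vector of norm less than 1, so the map is locally constant on
    a connected space. *)
Lemma lattice_valued_constant (f : P -> P) : continuous f ->
  (forall z, f z \in @lattice R) -> forall z, f z = f 0.
Proof.
move=> /continuousP_norm cf fl z.
have local x : exists2 d, 0 < d & forall y, `|x - y| < d -> f x = f y.
  have [d d0 Hd] := cf x 1 ltr01; exists d => // y /Hd xy.
  by apply/eqP; rewrite -subr_eq0; apply/eqP; apply: lattice_small => //; exact: rpredB.
suff : [set: P] `<=` [set z | f z = f 0] by exact.
apply: connected_subset_open; first exact: plane_connected.
- apply/openP_norm => x /= fx; have [d d0 Hd] := local x.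
  by exists d => // y /Hd <-.
- by exists 0.
- move=> x _ /closureP_norm clx; have [d d0 Hd] := local x.
  by have [y /= <- /Hd] := clx d d0.
Qed.

Lemma int_dist (t : R) : t \isn't a Num.int ->
  exists2 d, 0 < d & forall m : int, d <= `|t + m%:~R|.
Proof.
move=> tint.
have fl1 : (Num.floor t)%:~R < t.
  rewrite lt_neqAle floor_le andbT; apply/eqP => E.
  by move: tint; rewrite -E intr_int.
have fl2 := floorD1_gt t; rewrite intrD1 in fl2.
exists (Num.min (t - (Num.floor t)%:~R) ((Num.floor t)%:~R + 1 - t)) => [|m].
  by rewrite lt_min !subr_gt0 fl1.
rewrite leNgt lt_min; apply/negP => /andP[/ltr_normlP[h1 h2] /ltr_normlP[h3 h4]].
have : (Num.floor t)%:~R < ((- m)%:~R : R) by rewrite rmorphN; lra.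
have : ((- m)%:~R : R) < (Num.floor t + 1)%:~R by rewrite intrD1 rmorphN; lra.
by rewrite !ltr_int; lia.
Qed.

Lemma lattice_dist (x : P) : x \notin @lattice R -> exists2 d, 0 < d &
  forall m n, d <= `|x + vec m n|.
Proof.
rewrite negb_and => /orP[/int_dist|/int_dist] [d d0 Hd]; exists d => // m n;
  by rewrite prod_normE le_max Hd ?orbT.
Qed.

End TorusTopology.

(** * Integer iterates and invariance of the wandering set *)

Section Iterates.
Variables (X : topologicalType) (f : homeo X).

Lemma iterzS n x : iterz f (n + 1) x = f (iterz f n x).
Proof.
case: n => [n|[|n]].
- by rewrite -PoszD addn1.
- by rewrite /= homeo_invK.
- by rewrite (_ : Negz n.+1 + 1 = Negz n); [rewrite /= homeo_invK|rewrite !NegzE; lia].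
Qed.

Lemma iterzP n x : iterz f (n - 1) x = homeo_inv f (iterz f n x).
Proof. by rewrite -{2}(subrK 1 n) iterzS homeoK. Qed.

Lemma iterzD m n x : iterz f (m + n) x = iterz f m (iterz f n x).
Proof.
elim/int_rect: m => [|m IH|m IH]; first by rewrite add0r.
- by rewrite -addn1 PoszD addrAC !iterzS IH.
- by rewrite -addn1 PoszD opprD addrAC !iterzP IH.
Qed.

Lemma iterz_continuous n : continuous (iterz f n).
Proof.
have it (g : X -> X) k : continuous g -> continuous (iter k g).
  move=> cg; elim: k => [|k IH] x; first exact: cvg_id.
  by apply: (@continuous_comp _ _ _ (iter k g) g); [exact: IH|exact: cg].
by case: n => k; apply: it; [exact: homeo_continuous|exact: homeo_inv_continuous].
Qed.

Lemma iterzK n x : iterz f (- n) (iterz f n x) = x.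
Proof. by rewrite -iterzD addNr. Qed.

Lemma iterzNK n x : iterz f n (iterz f (- n) x) = x.
Proof. by rewrite -iterzD subrr. Qed.

Lemma wandering_image n U : wandering f U -> wandering f (iterz f n @` U).
Proof.
move=> [oU wU]; split.
  rewrite (_ : _ @` _ = iterz f (- n) @^-1` U).
    by apply: open_comp => // x _; exact: iterz_continuous.
  apply/seteqP; split => [_ [x Ux <-]|x Ux]; first by rewrite /= iterzK.
  by exists (iterz f (- n) x) => //; rewrite iterzNK.
move=> k k0; apply/seteqP; split => // y [[_ [u Uu <-] <-] [v Uv E]].
have : (iterz f k @` U `&` U) v.
  by split => //; exists u => //; rewrite -(iterzK n v) E -!iterzD; congr (iterz f _ u); lia.
by rewrite wU.
Qed.

Lemma wandering_setP x : wandering_set f x <-> exists U, wandering f U /\ U x.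
Proof.
split=> [H|H nH]; last exact: nH.
by apply: contrapT => nU; apply: H.
Qed.

Lemma wandering_set_open : open (wandering_set f).
Proof.
rewrite (_ : wandering_set f = \bigcup_(U in wandering f) U).
  by apply: bigcup_open => U [].
apply/seteqP; split => [x /wandering_setP[U [wU Ux]]|x [U wU Ux]]; first by exists U.
by apply/wandering_setP; exists U.
Qed.

Lemma wandering_set_iterz n x : wandering_set f x -> wandering_set f (iterz f n x).
Proof.
move=> /wandering_setP[U [wU Ux]]; apply/wandering_setP.
by exists (iterz f n @` U); split; [exact: wandering_image|exists x].
Qed.

End Iterates.

(** * The plane action defined by a lift with bounded deviations *)

Section Semiconjugacy.
Variable R : realType.
Local Notation P := (R * R)%type.
Local Notation T := (int * int * int)%type.
Local Notation vec := (@vec R).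
Variables (f : homeo (torus R)) (F : homeo P) (r : P) (C : R).
Hypotheses (Ff : is_lift F f).
Hypothesis dev : forall z (n : int), `|iterz F n z - z - n%:~R *: r| <= C.

(** For a lattice vector v, F(z + v) - F(z) is a constant [a], so F(kv) = F(0) + ka. The deviation
    bound at time 1 keeps k(a - v) bounded in k, whence a = v. *)
Lemma lift_translation z m n : F (z + vec m n) = F z + vec m n.
Proof.
have [a Ha] : exists a, forall z, F (z + vec m n) - F z = a.
  pose g z := F (z + vec m n) - F z.
  exists (g 0); apply: lattice_valued_constant => x.
    apply: cvgB; last exact: homeo_continuous.
    apply: continuous_cvg; first exact: homeo_continuous.
    by apply: cvgD; [exact: cvg_id|exact: cvg_cst].
  by apply/tproj_eq; rewrite !Ff tproj_vec.
suff E : a = vec m n by rewrite -[in RHS]E -(Ha z) [RHS]addrC subrK.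
have iterate k : F (0 + vec m n *+ k) = F 0 + a *+ k.
  elim: k => [|k IH]; first by rewrite !mulr0n !addr0.
  by rewrite !mulrSr addrA [RHS]addrA -IH -(Ha (0 + vec m n *+ k)) [RHS]addrC subrK.
apply/eqP; rewrite -subr_eq0 -normr_eq0 eq_le normr_ge0 andbT leNgt.
apply/negP => av0.
have bound k : `|a - vec m n| * k%:R <= C + C.
  rewrite mulr_natr -normrMn mulrnBl.
  have := dev (0 + vec m n *+ k) 1; have := dev 0 1; rewrite /= scale1r iterate.
  set x := F 0 - 0 - r => x1 x2.
  have ident (u p q t : P) : p - q = (u + p - (0 + q) - t) - (u - 0 - t).
    by rewrite add0r subr0 opprB addrA subrK (addrC u) addrAC addrK.
  rewrite (ident (F 0) _ _ r) -/x.
  by rewrite (le_trans (ler_normB _ _)) // lerD.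
have := bound (Num.bound `|(C + C) / `|a - vec m n| |).
apply/negP; rewrite -ltNge mulrC -ltr_pdivrMr //.
by rewrite (le_lt_trans (ler_norm _)) // archi_boundP.
Qed.

Lemma iterz_translation k z m n : iterz F k (z + vec m n) = iterz F k z + vec m n.
Proof.
have inv z' : homeo_inv F (z' + vec m n) = homeo_inv F z' + vec m n.
  by rewrite -{1}(homeo_invK F z') -lift_translation homeoK.
elim/int_rect: k => [//|k IH|k IH].
  by rewrite -addn1 PoszD !iterzS IH lift_translation.
by rewrite -addn1 PoszD opprD !iterzP IH inv.
Qed.

Lemma iterz_lift k z : tproj (iterz F k z) = iterz f k (tproj z).
Proof.
have inv z' : tproj (homeo_inv F z') = homeo_inv f (tproj z').
  by rewrite -{2}(homeo_invK F z') Ff homeoK.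
elim/int_rect: k => [//|k IH|k IH].
  by rewrite -addn1 PoszD !iterzS Ff IH.
by rewrite -addn1 PoszD opprD !iterzP inv IH.
Qed.

(** Two lifts differ by a constant lattice vector [a], so their n-th iterates differ by [n a];
    bounded deviations leave [r + a] as the only possible limit. *)
Lemma lift_rotation (F' : homeo P) r' : is_lift F' f -> rotation_set F' = [set r'] ->
  tproj r' = tproj r.
Proof.
move=> F'f rot.
have [a [al Ha]] : exists a, a \in @lattice R /\ forall z, F' z = F z + a.
  pose g z := F' z - F z.
  have gl z : g z \in @lattice R by apply/tproj_eq; rewrite Ff F'f.
  exists (g 0); split => // z; rewrite -(@lattice_valued_constant _ g _ gl z).
    by rewrite addrC subrK.
  by move=> x; apply: cvgB; exact: homeo_continuous.
have [p [q aE]] := latticeP _ al.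
have iterF' n z : iter n F' z = iter n F z + a *+ n.
  have shift k y : F (y + a *+ k) = F y + a *+ k.
    elim: k => [|k IH]; first by rewrite !mulr0n !addr0.
    by rewrite !mulrSr !addrA {2 4}aE lift_translation IH.
  elim: n => [|n IH]; first by rewrite mulr0n addr0.
  by rewrite /= IH Ha shift mulrSr addrA.
suff -> : r' = r + a by rewrite aE tproj_vec.
apply/eqP; rewrite -subr_eq0 -normr_le0; apply/ler_addgt0Pr => e e0; rewrite add0r.
have C0 : 0 <= C by apply: le_trans (dev 0 0); exact: normr_ge0.
have e20 : 0 < e / 2 by lra.
pose m := (Num.bound (C / (e / 2))).+1.
have : rotation_set F' r' by rewrite rot.
move=> /(_ m I) /closureP_norm/(_ _ e20)[x [n /= mn [z _ <-]] r'x].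
have n0 : 0 < (n%:R : R) by rewrite ltr0n (leq_trans _ mn).
apply: le_trans (ler_distD (n%:R^-1 *: (iter n F' z - z)) _ _) _.
suff : `|n%:R^-1 *: (iter n F' z - z) - (r + a)| <= e / 2 by lra.
have -> : iter n F' z - z = iterz F n z - z - n%:~R *: r + n%:R *: (r + a).
  by rewrite iterF' -pmulrn scalerDr addrA subrK scaler_nat addrAC.
rewrite scalerDr (scalerA _ n%:R) mulVf ?gt_eqF // scale1r addrK.
rewrite normrZ gtr0_norm ?invr_gt0 // ler_pdivrMl //.
apply: le_trans (dev z n) _; rewrite -ler_pdivrMr //.
apply: ltW (lt_le_trans (archi_boundP _) _); first by rewrite divr_ge0 // ltW.
by rewrite ler_nat (leq_trans _ mn).
Qed.

Definition torus_act (g : T) z := iterz F g.1.1 z + vec g.1.2 g.2.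

(** A relation makes the closed subgroup where [lin] is an integer invariant under the translation.
    By minimality it is the whole torus, and a nonzero coefficient would make 1/2 an integer. *)
Lemma totally_irrational_independent (a c d : int) : totally_irrational r ->
  a%:~R * r.1 + c%:~R * r.2 + d%:~R = 0 -> [/\ a = 0, c = 0 & d = 0].
Proof.
move=> mini E; pose lin (z : P) : R := a%:~R * z.1 + c%:~R * z.2.
have linD x y : lin (x + y) = lin x + lin y by rewrite /lin /=; ring.
pose K := @tproj R @` [set z | lin z \is a Num.int].
have Kint z : K (tproj z) -> lin z \is a Num.int.
  move=> [x xint /tprojP[m [n ->]]]; rewrite linD rpredD // /lin /vec /=.
  by rewrite -!intrM -intrD intr_int.
have lin_r : lin r = (- d)%:~R by rewrite rmorphN /lin; lra.
have cK : closed K.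
  rewrite -[K]setCK; apply: open_closedC.
  change (open (@tproj R @^-1` (~` K))).
  apply/openP_norm => z nz.
  have zint : lin z \isn't a Num.int by apply/negP => zi; apply: nz; exists z.
  have [e e0 He] := int_dist zint.
  pose B : R := `|a%:~R| + `|c%:~R| + 1.
  have B0 : 0 < B by rewrite ltr_pwDr // addr_ge0.
  exists (e / B) => [|y]; first by rewrite divr_gt0.
  rewrite ltr_pdivlMr // => zy /Kint/intrP[k Ek].
  have := He (- k); apply/negP; rewrite -ltNge rmorphN /= -Ek.
  apply: le_lt_trans zy; have -> : lin z - lin y = lin (z - y) by rewrite /lin /=; ring.
  rewrite /lin (le_trans (ler_normD _ _)) // !normrM mulrC.
  have := norm_crd false (z - y); have := norm_crd true (z - y); rewrite /crd /= => h1 h2.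
  have := ler_wpM2l (normr_ge0 (a%:~R : R)) h2; have := ler_wpM2l (normr_ge0 (c%:~R : R)) h1.
  by rewrite /B; have := normr_ge0 (z - y); lra.
have inv : translation r @` K = K.
  apply/seteqP; split => [_ [_ [z zint <-] <-]|_ [z zint <-]].
    by rewrite translation_tproj; exists (z + r) => //=; rewrite linD lin_r rpredD // intr_int.
  exists (tproj (z - r)); last by rewrite translation_tproj subrK.
  exists (z - r) => //=; have -> : lin (z - r) = lin z - lin r by rewrite /lin /=; ring.
  by rewrite lin_r rpredB // intr_int.
have [K0|KT] := mini K cK inv.
  have : K (tproj 0) by exists 0 => //=; rewrite /lin !mulr0 addr0 rpred0.
  by rewrite K0.
have half (k : int) : (k%:~R * (2 * k%:~R)^-1 : R) \is a Num.int -> k = 0.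
  move=> /intrP[m Em]; apply/eqP/negPn/negP => k0.
  have k0' : (k%:~R : R) != 0 by rewrite intr_eq0.
  have : (1 : R) = 2 * m%:~R by rewrite -Em; field.
  move=> E1; have : (1%:~R : R) = (2 * m)%:~R by rewrite intrM.
  by move=> /intr_inj; lia.
have a0 : a = 0.
  apply: half; have := @Kint ((2 * a%:~R)^-1, 0); rewrite KT /lin /= mulr0 addr0.
  by apply.
have c0 : c = 0.
  apply: half; have := @Kint (0, (2 * c%:~R)^-1); rewrite KT /lin /= mulr0 add0r.
  by apply.
split => //; move: E; rewrite a0 c0 !mul0r !add0r => /eqP.
by rewrite intr_eq0 => /eqP.
Qed.

Lemma torus_plane_action : totally_irrational r -> plane_action torus_act r C.
Proof.
move=> irr; split.
- by move=> z; rewrite /torus_act /= /vec addr0.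
- move=> [[n p] q] [[n' p'] q'] z; rewrite /torus_act /= iterz_translation iterzD -addrA.
  by rewrite -vecD (addrC p) (addrC q).
- move=> g z; apply: cvgD; [exact: iterz_continuous|exact: cvg_cst].
- by [].
- move=> [[n p] q] z; rewrite /torus_act /rotv /=.
  by rewrite (addrAC _ (vec p q)) opprD addrA (addrAC _ (vec p q)) addrK.
- by move=> a c d; exact: totally_irrational_independent.
Qed.

Lemma tproj_act g z : tproj (torus_act g z) = iterz f g.1.1 (tproj z).
Proof. by rewrite /torus_act tproj_vec iterz_lift. Qed.

Let W : set P := @tproj R @^-1` wandering_set f.

Lemma wandering_lift_open : open W.
Proof.
apply: open_comp; last exact: wandering_set_open.
by move=> x _; exact: tproj_continuous.
Qed.

Lemma wandering_lift_act g z : W z -> W (torus_act g z).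
Proof. by rewrite /W /= tproj_act; exact: wandering_set_iterz. Qed.

Hypothesis irr : totally_irrational r.

Let HG := torus_plane_action irr.

Lemma nonwandering_lift w : ~ W w -> forall (e : R) (N : nat), 0 < e ->
  exists u g, [/\ `|w - u| < e, `|w - torus_act g u| < e & (N <= `|g.1.1|)%N].
Proof.
move=> Ww e N e0.
(* If F^n(w) - w were a lattice vector, an element of time [n] would fix [w], against the drift of
   its multiples. Hence it has positive distance to the lattice, and no return near [w] takes time
   [n]. *)
have one n : n != 0 -> exists2 d, 0 < d & forall u g, g.1.1 = n ->
    `|w - u| < d -> `|w - torus_act g u| < d -> False.
  move=> n0; have [d d0 Hd] : exists2 d, 0 < d & forall p q,
      d <= `|iterz F n w - w + vec p q|.
    apply: lattice_dist; apply/negP => /latticeP[p [q E]].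
    have [|k] := act_escapes HG w 0 (_ : ((n, - p, - q) : T).1.1 != 0) => //.
    suff fixed : torus_act (n, - p, - q) w = w.
      elim: k => [|k IH]; first by rewrite mulr0n (act0 HG) subrr normr0 ltxx.
      by rewrite mulrSr (actD HG) fixed.
    by rewrite /torus_act /= vecN -E opprB addrC subrK.
  have d20 : 0 < d / 2 by lra.
  have [c c0 Hc] := proj1 (continuousP_norm _) (@iterz_continuous _ F n) w _ d20.
  exists (Num.min c (d / 2)); first by rewrite lt_min c0.
  move=> u [[_ p] q] /= ->; rewrite !lt_min => /andP[/Hc wu _] /andP[_ wgu].
  have := Hd p q; apply/negP; rewrite -ltNge.
  have -> : iterz F n w - w + vec p q = (iterz F n w - iterz F n u) -
      (w - torus_act (n, p, q) u).
    by rewrite /torus_act /= opprB addrA (addrA (_ - _)) subrK addrAC.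
  by rewrite (le_lt_trans (ler_normB _ _)) //; lra.
(* Excluding the finitely many nonzero times below [N] makes any return close to [w] long. *)
have [d d0 Hd] : exists2 d, 0 < d & forall u g, g.1.1 != 0 ->
    `|w - u| < d -> `|w - torus_act g u| < d -> (N <= `|g.1.1|)%N.
  elim: (N) => [|k [d d0 IH]]; first by exists 1.
  have [->|k0] := eqVneq k 0%N; first by exists 1 => // u g; rewrite absz_gt0.
  have [|d1 d10 H1] := one k; first by rewrite eqz_nat.
  have [|d2 d20 H2] := one (- k%:Z); first by rewrite oppr_eq0 eqz_nat.
  exists (Num.min d (Num.min d1 d2)); first by rewrite !lt_min d0 d10.
  move=> u g g0; rewrite !lt_min => /and3P[u0 u1 u2] /and3P[v0 v1 v2].
  rewrite ltn_neqAle (IH u g) // andbT; apply/eqP => kg.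
  have [E|E] : g.1.1 = k \/ g.1.1 = - k%:Z by lia.
    exact: H1 E u1 v1.
  exact: H2 E u2 v2.
pose U := @tproj R @` [set u | `|w - u| < Num.min e d].
have m0 : 0 < Num.min e d by rewrite lt_min e0.
have nwU : ~ wandering f U.
  move=> wU; apply: Ww; apply/wandering_setP; exists U; split => //.
  by exists w => //=; rewrite subrr normr0.
have [n [n0 [y [[_ [u wu <-] <-] [v wv E]]]]] : exists n : int, n != 0 /\
    (iterz f n @` U `&` U) !=set0.
  apply: contrapT => Hno; apply: nwU; split; first exact/tproj_open/ball_open.
  move=> n n0; apply/seteqP; split => // y Uy.
  by apply: Hno; exists n; split => //; exists y.
move: wu wv; rewrite /= !lt_min => /andP[wue wud] /andP[wve wvd].
have /tprojP[p [q vE]] : tproj (iterz F n u) = tproj v by rewrite iterz_lift.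
exists u, (n, p, q); rewrite {1}/torus_act /= -vE; split => //.
by apply: (Hd u (n, p, q)) => //; rewrite /torus_act /= -vE.
Qed.

End Semiconjugacy.

(** * Lifting the smallness of wandering domains to the plane *)

Section SmallDomains.
Variable R : realType.
Local Notation P := (R * R)%type.
Local Notation vec := (@vec R).

Lemma norm_le_enorm (z : P) : `|z| <= enorm z.
Proof.
by rewrite norm_le /enorm -!sqrtr_sqr !ler_wsqrtr // ?lerDl ?lerDr sqr_ge0.
Qed.

Lemma tdist_lt (x y : P) e : tdist (tproj x) (tproj y) < e ->
  exists m n, `|x - y + vec m n| < e.
Proof.
move=> /inf_lt[|_ [[a b] [/= /tprojP[m [n ->]] /tprojP[m' [n' ->]]] <-]].
  by exists (enorm (x - y)), (x, y).
move=> /(le_lt_trans (norm_le_enorm _)) /= H; exists (m' - m), (n' - n).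
by rewrite vecD vecN [X in _ + X]addrC addrACA addrK opprD subrK.
Qed.

Lemma component_translation (W : set P) z x m n : (forall x m n, W x -> W (x + vec m n)) ->
  connected_component W z x -> connected_component W (z + vec m n) (x + vec m n).
Proof.
move=> WT [B [Bz BW cB] Bx].
exists ((fun y => y + vec m n) @` B); last by exists x.
split; [by exists z|by move=> _ [u /BW Wu <-]; exact: WT|].
apply: connected_continuous_connected => //; apply: continuous_subspaceT => y.
by apply: cvgD; [exact: cvg_id|exact: cvg_cst].
Qed.

Lemma finite_box (N : nat) :
  finite_set [set p : int * int | (`|p.1| <= N)%N && (`|p.2| <= N)%N].
Proof.
have fin1 : finite_set [set k : int | (`|k| <= N)%N].
  apply: (@sub_finite_set _ _ ((fun k : nat => k%:Z - N%:Z) @` `I_(N + N).+1)).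
    move=> k /= kN; exists (absz (k + N%:Z)) => /=; lia.
  exact/finite_image/finite_II.
apply: sub_finite_set (finite_setX fin1 fin1).
by move=> [a c] /= /andP[].
Qed.

Variable f : homeo (torus R).
Hypothesis small : small_wandering_domains f.

Let w := wandering_set f.
Let W : set P := @tproj R @^-1` w.

Let oW : open W.
Proof. exact: wandering_lift_open. Qed.

Let WT x m n : W x -> W (x + vec m n).
Proof. by rewrite /W /= tproj_vec. Qed.

Lemma tproj_component z x : connected_component W z x ->
  connected_component w (tproj z) (tproj x).
Proof.
move=> [B [Bz BW cB] Bx]; exists (@tproj R @` B); last by exists x.
split; [by exists z|by move=> _ [u /BW Wu <-]|].
apply: connected_continuous_connected => //; apply: continuous_subspaceT.
exact: tproj_continuous.
Qed.

(** The component of [z] and the part of [W] avoiding all its translates project to disjoint open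
    sets covering the component of [tproj z]; by connectedness the first covers it alone. *)
Lemma component_over z z' : W z -> connected_component w (tproj z) (tproj z') ->
  exists m n, connected_component W (z + vec m n) z'.
Proof.
move=> Wz zz'.
pose A := @tproj R @` connected_component W z.
pose B := @tproj R @` [set y | W y /\ forall m n, ~ connected_component W z (y + vec m n)].
have oA : open A by apply: tproj_open; exact: open_component.
have oB : open B.
  apply: tproj_open; apply/openP_norm => y [Wy ny].
  have /openP_norm/(_ y)[|e e0 He] := @open_component _ W y oW.
    exact: connected_component_refl.
  exists e => // y' /He yy'; split; first exact: connected_component_sub yy'.
  move=> m n zy'; apply: (ny m n); apply: connected_component_trans zy' _.
  exact/connected_component_sym/component_translation.
have AB y : A y -> ~ B y.
  by move=> [u zu <-] [v [_ nv] /tprojP[m [n E]]]; apply: (nv m n); rewrite -E.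
have cover y : connected_component w (tproj z) y -> A y \/ B y.
  move=> zy; have [u E] := tproj_repr y; rewrite -E in zy *.
  have Wu : W u by exact: connected_component_sub zy.
  have [[m [n zu]]|nzu] := pselect (exists m n, connected_component W z (u + vec m n)).
    by left; exists (u + vec m n) => //; exact: tproj_vec.
  by right; exists u => //; split => // m n zu; apply: nzu; exists m, n.
have : connected_component w (tproj z) `&` A = connected_component w (tproj z).
  apply: component_connected.
  - exists (tproj z); split; first exact: connected_component_refl.
    by exists z => //; exact: connected_component_refl.
  - by exists A.
  - exists (~` B); first exact: open_closedC.
    by apply/seteqP; split=> y [zy]; [split => //; exact: AB|case: (cover y zy)].
move=> /seteqP[_ /(_ _ zz')[_ [u zu /tprojP[m [n ->]]]]].
exists m, n; exact: component_translation.
Qed.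

Lemma lifted_domains_small : small_domains W.
Proof.
have [bounded fin] := small.
have bounded_component z : exists d, forall x, connected_component W z x -> `|x| <= d.
  have [Wz|Wz] := pselect (W z); last first.
    by exists 0 => x; rewrite connected_component_out.
  pose D := connected_component (@tproj R @^-1` connected_component w (tproj z)) z.
  have [d Hd] : exists d, forall x, D x -> `|x| <= d.
    have : bounded_set D.
      apply: (bounded (connected_component w (tproj z))); first by exists (tproj z).
      by exists z => //; exact: connected_component_refl.
    by move=> [d [_ Hd]]; exists (d + 1) => x; apply: Hd; rewrite ltrDl.
  exists d => x zx; apply: Hd.
  apply: (@connected_component_max _ _ (connected_component W z)) => //.
  - exact: connected_component_refl.
  - by move=> y /tproj_component.
  - exact: component_connected.
(* The bound 1/4 makes lattice shifts harmless: a shift compatible with three distances below [e']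
   has norm below 3/4, hence vanishes. A plane component over a domain of diameter below [e'] is
   thus itself that small. *)
split=> // e d e0; pose e' := Num.min e (1 / 4).
have e'0 : 0 < e' by rewrite lt_min e0; lra.
have finU := fin e' e'0.
pose over U := [set O | components W O /\ (exists2 x, O x & `|x| <= d) /\
  @tproj R @` O `<=` U].
set US := [set U | _] in finU.
apply: (@sub_finite_set _ _ (\bigcup_(U in US) (over U))).
  move=> _ [[z Wz <-] [[x zx xd] [y [y' [zy zy' yy']]]]].
  exists (connected_component w (tproj z)); last first.
    split; [by exists z|split; first by exists x].
    by move=> _ [u /tproj_component zu <-].
  split; first by exists (tproj z).
  rewrite leNgt; apply/negP => diam.
  have near u u' : connected_component W z u -> connected_component W z u' ->
      exists m n, `|u - u' + vec m n| < e'.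
    move=> /tproj_component zu /tproj_component zu'; apply: tdist_lt.
    rewrite -lte_fin; apply: le_lt_trans diam.
    by apply: ereal_sup_ubound; exists (tproj u, tproj u').
  have : connected_component W z `<=` [set u | `|y - u| < e'].
    apply: connected_subset_open; [exact: component_connected|exact: ball_open| |].
      by exists y; split => //=; rewrite subrr normr0.
    move=> u zu /closureP_norm/(_ _ e'0)[v /= yv uv].
    have [m [n yu]] := near y u zy zu.
    have e'4 : e' <= 1 / 4 by rewrite ge_min lexx orbT.
    suff E : vec m n = 0 by rewrite E addr0 in yu.
    apply: lattice_small; first by apply/latticeP; exists m, n.
    rewrite -[vec m n](addKr (y - u)) addrC (le_lt_trans (ler_normB _ _)) //.
    have := ler_distD v y u; rewrite (distrC v u); lra.
  move=> /(_ y' zy') /=; rewrite ltNge => /negP; apply.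
  by rewrite (le_trans _ yy') // ge_min lexx.
(* All components over one domain are lattice translates of a single one, and those meeting the ball
   are obtained from boundedly many lattice vectors. *)
apply: bigcup_finite => // _ [[x0 wx0 <-] _].
have [[_ [[z1 Wz1 <-] [_ O1U]]]|none] :=
    pselect (over (connected_component w x0) !=set0); last first.
  suff -> : over (connected_component w x0) = set0 by exact: finite_set0.
  by apply/seteqP; split => // O OU; apply: none; exists O.
have [d1 Hd1] := bounded_component z1.
have box := finite_box (Num.bound (`|d| + `|d1|)).
apply: sub_finite_set (finite_image (fun p => connected_component W (z1 + vec p.1 p.2)) box).
move=> _ [[z2 Wz2 <-] [[x z2x xd] OU]].
have base z : W z -> @tproj R @` connected_component W z `<=` connected_component w x0 ->
    connected_component w x0 (tproj z).
  by move=> Wz; apply; exists z => //; exact: connected_component_refl.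
have z12 : connected_component w (tproj z1) (tproj z2).
  apply: connected_component_trans (base z2 Wz2 OU).
  exact/connected_component_sym/base.
have [m [n zz]] := component_over Wz1 z12.
exists (m, n) => /=; last exact: same_connected_component.
have : `|vec m n| <= `|d| + `|d1|.
  have := component_translation (- m) (- n) WT (connected_component_trans zz z2x).
  rewrite vecN addrK => /Hd1 xd1.
  rewrite -[vec m n](subKr x) (le_trans (ler_normB _ _)) // lerD //.
    exact: le_trans xd (ler_norm _).
  exact: le_trans xd1 (ler_norm _).
have := archi_boundP (addr_ge0 (normr_ge0 d) (normr_ge0 d1)).
move=> /[swap] /le_lt_trans /[apply]; rewrite norm_lt /vec /= -!intr_norm -!abszE.
by rewrite -!pmulrn !ltr_nat => /andP[/ltnW -> /ltnW ->].
Qed.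

End SmallDomains.

(** * Assembling two invariant coordinates into a semiconjugacy *)

Theorem corollary1p1 (R : realType) (f : homeo (torus R))
    (f_id : @homotopic R (torus R) (torus R) f id) :
  (nonwandering f -> small_wandering_domains f) /\
  (totally_irrational_pseudo_rotation f ->
   uniformly_bounded_deviations f ->
   small_wandering_domains f ->
   forall (F : homeo (R * R)%type) (r : R * R),
     is_lift F f -> rotation_set F = [set r] ->
     exists h : torus R -> torus R,
       [/\ continuous h, h @` [set: torus R] = [set: torus R] &
           h \o f = translation r \o h]).
Proof.
split=> [nw|].
  have w0 : wandering_set f = set0 by rewrite /wandering_set nw setCT.
  have none U : ~ components (wandering_set f) U by rewrite w0 => -[].
  split=> [U /none //|e e0].
  rewrite (_ : [set U | _] = set0); first exact: finite_set0.
  by apply/seteqP; split => // U [/none].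
move=> [F1 [r1 [F1f rot1 irr1]]] [F0 [r0 [F0f _ [C C0 dev]]]] small F r Ff rot.
have dev0 z (n : int) : `|iterz F0 n z - z - n%:~R *: r0| <= C.
  exact: le_trans (norm_le_enorm _) (dev z n).
(* The hypotheses may concern different lifts, but all their rotation vectors define the same
   translation; everything is therefore done with [F0]. *)
have same F' r' : is_lift F' f -> rotation_set F' = [set r'] ->
    translation r' = translation r0.
  move=> F'f rot'; have E := lift_rotation F0f dev0 F'f rot'.
  by apply/funext => x; have [z <-] := tproj_repr x; rewrite /translation -/(tproj _) E.
have irr : totally_irrational r0.
  by rewrite /totally_irrational -(same F1 r1).
rewrite (same F r) //.
have HG := torus_plane_action F0f dev0 irr.
have HW := lifted_domains_small small.
have [H1 [B1 [H1act H1bound H1cont]]] := invariant_coordinate false HG HW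
  (@wandering_lift_open R f) (@wandering_lift_act _ _ _ F0f) (nonwandering_lift F0f dev0 irr).
have [H2 [B2 [H2act H2bound H2cont]]] := invariant_coordinate true HG HW
  (@wandering_lift_open R f) (@wandering_lift_act _ _ _ F0f) (nonwandering_lift F0f dev0 irr).
pose H z := (H1 z, H2 z).
have Hact g z : H (torus_act F0 g z) = H z + rotv r0 g.
  by rewrite /H H1act H2act.
have Hvec z m n : H (z + vec R m n) = H z + vec R m n.
  have := Hact (0, m, n) z; rewrite /torus_act /rotv /= scale0r add0r.
  by [].
have HF z : H (F0 z) = H z + r0.
  have := Hact (1, 0, 0) z; rewrite /torus_act /rotv /= scale1r.
  by rewrite /vec !addr0.
have Hcont : continuous H.
  apply/continuousP_norm => x e e0; have e20 : 0 < e / 2 by lra.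
  have [d1 d10 Hd1] := H1cont x _ e20; have [d2 d20 Hd2] := H2cont x _ e20.
  exists (Num.min d1 d2) => [|y]; first by rewrite lt_min d10.
  rewrite lt_min norm_lt => /andP[/Hd1 h1 /Hd2 h2] /=.
  by apply/andP; split; [apply: le_lt_trans h1 _|apply: le_lt_trans h2 _]; lra.
(* The choice of representative is immaterial because [H] commutes with lattice translations. *)
pose h (x : torus R) : torus R := tproj (H (repr (x : Quotient.quot (@lattice R)))).
have hE z : h (tproj z) = tproj (H z).
  rewrite /h; set z' := repr _.
  have /tprojP[m [n ->]] : tproj z' = tproj z by rewrite /z' /tproj reprK.
  by rewrite Hvec tproj_vec.
have hf : h \o f = translation r0 \o h.
  apply/funext => x /=; have [z <-] := tproj_repr x.
  by rewrite -F0f !hE HF translation_tproj.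
exists h; split => //.
  apply/continuousP => A oA.
  change (open (@tproj R @^-1` (h @^-1` A))).
  rewrite (_ : _ @^-1` _ = H @^-1` (@tproj R @^-1` A)).
    apply: open_comp; first by move=> x _; exact: Hcont.
    exact: (open_comp (fun x _ => @tproj_continuous R x) oA).
  by apply/seteqP; split => z; rewrite /= hE.
(* The image is nonempty, closed and invariant under a minimal translation, hence everything. *)
pose K := h @` [set: torus R].
have closedK : closed K.
  rewrite -[K]setCK; apply: open_closedC.
  change (open (@tproj R @^-1` (~` K))).
  apply/openP_norm => y nK; pose rho := `|y| + 1 + `|B1| + `|B2|.
  (* By the bounds on [H], any preimage of a point within distance 1 of [y] lies in this ball, so
     near [y] the lifted image agrees with a compact set. *)
  have cQ : closed (H @` cball 0 rho).
    apply: compact_closed; first exact: norm_hausdorff.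
    by apply: continuous_compact; [exact: continuous_subspaceT|exact: cball_compact].
  have /openP_norm/(_ y)[|e e0 He] : open (~` (H @` cball 0 rho)) by rewrite openC.
    by move=> [z _ Hz]; apply: nK; exists (tproj z) => //; rewrite hE Hz.
  exists (Num.min e 1) => [|y']; first by rewrite lt_min e0 ltr01.
  rewrite lt_min => /andP[/He nQ yy'] [x _]; have [z <-] := tproj_repr x.
  rewrite hE => /tprojP[m [n y'E]]; rewrite -Hvec in y'E.
  apply: nQ; exists (z + vec R m n) => //; rewrite /cball /= sub0r normrN.
  have y'1 : `|y'| <= `|y| + 1.
    by rewrite -[y'](subKr y) (le_trans (ler_normB _ _)) // lerD2l ltW.
  move: y'1; rewrite y'E norm_le /= => /andP[n1 n2].
  have := ler_norm B1; have := ler_norm B2; have := H1bound (z + vec R m n).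
  have := H2bound (z + vec R m n); have := normr_ge0 B1; have := normr_ge0 B2.
  by rewrite norm_le /rho /crd => *; apply/andP; split; lra.
have [K0|//] : K = set0 \/ K = setT.
  apply: irr; first exact: closedK.
  apply/seteqP; split => [_ [_ [x _ <-] <-]|_ [x _ <-]].
    by exists (f x) => //; rewrite -[LHS]/((h \o f) x) hf.
  exists (h (homeo_inv f x)); first by exists (homeo_inv f x).
  by rewrite -[LHS]/((translation r0 \o h) _) -hf /= homeo_invK.
have : K (h (tproj 0)) by exists (tproj 0).
by rewrite K0.
Qed.
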